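(* Let $n,m\ge1$ be integers, $\alpha_1,\alpha_2\in[-2(\sqrt2-1),2(\sqrt2-1)]$ and $t\in[0,1]$. Let $f_{\alpha_1,n}=h_{\alpha_1,n}+\overline{g_{\alpha_1,n}}$ and $f_{\alpha_2,m}=h_{\alpha_2,m}+\overline{g_{\alpha_2,m}}$ be normalized harmonic mappings on $\mathbb{D}$ with $$h_{\alpha_1,n}+g_{\alpha_1,n}=F_{\alpha_1,n},\qquad h_{\alpha_2,m}+g_{\alpha_2,m}=F_{\alpha_2,m},$$ and with $|g_{\alpha_1,n}'/h_{\alpha_1,n}'|<1$ and $|g_{\alpha_2,m}'/h_{\alpha_2,m}'|<1$ in $\mathbb{D}$, where for an integer $N\geq 1$ and real $\alpha$ $$F_{\alpha,N}(z)=\left(\frac{z\left(\prod_{k=1}^{N-1}(1+z^{2^k})\right)\left(1+z^{2^N}+\alpha z^{2^{N-1}}\right)}{1+z^{2^{N+1}}}\right)*\log\frac1{1-z}.$$ If the convex combination $f=tf_{\alpha_1,n}+(1-t)f_{\alpha_2,m}$ is locally univalent and sense-preserving in $\mathbb{D}$, then $f\in\mathcal{S}_H$ and $f$ is convex in the direction of the imaginary axis.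
   Context: $\mathbb{D}=\{z\in\mathbb{C}:|z|<1\}$. Harmonic functions on $\mathbb{D}$ are written $f=h+\overline{g}$ with $h,g$ analytic on $\mathbb{D}$; the dilatation is $\omega=g'/h'$. ''Normalized'' means $h(0)=g(0)=0$ and $h'(0)=1$. $\mathcal{S}_H$ is the class of harmonic, sense-preserving, univalent (injective) mappings $f$ on $\mathbb{D}$ with $f(0)=0$, $f_z(0)=1$. The Hadamard product of $\sum_{k\ge1}a_kz^k$ and $\sum_{k\ge1}b_kz^k$ is $\sum_{k\ge1}a_kb_kz^k$. Empty products equal $1$ (so for $N=1$ the numerator is $z(1+z^2+\alpha z)$). A univalent mapping of $\mathbb{D}$ is convex in the direction of the imaginary axis if the intersection of its image with every vertical line is connected or empty. *)

(* Defs.v *)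
From Stdlib Require Import Reals List Factorial.
From Coquelicot Require Import Coquelicot.

Open Scope R_scope.

Definition unit_disk (z : C) : Prop := Cmod z < 1.

Definition analytic_on_disk (h : C -> C) : Prop :=
  forall z : C, unit_disk z -> ex_derive (K := C_AbsRing) (V := C_NormedModule) h z.

Fixpoint C_derive_n (f : C -> C) (n : nat) : C -> C :=
  match n with
  | O => f
  | S p => C_derive (C_derive_n f p)
  end.

Definition taylor_coeff (f : C -> C) (k : nat) : C :=
  (C_derive_n f k (RtoC 0) / RtoC (INR (fact k)))%C.

(** Coquelicot's [Series] is real-valued; complex sums are taken
    componentwise. *)
Definition CSeries (a : nat -> C) : C :=
  (Series (fun k => Re (a k)), Series (fun k => Im (a k))).

(** For functions analytic at the origin, identified with their power series
    there.  The sum starts at [k = 0]; the factors used below vanish at [0],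
    so that this term is zero. *)
Definition hadamard (f g : C -> C) (z : C) : C :=
  CSeries (fun k => taylor_coeff f k * taylor_coeff g k * z ^ k)%C.

(** Principal argument, in (-PI, PI], with value 0 at the origin. *)
Definition Carg (w : C) : R :=
  let x := Re w in
  let y := Im w in
  if Rlt_dec 0 x then atan (y / x)
  else if Rlt_dec x 0 then
    (if Rle_dec 0 y then atan (y / x) + PI else atan (y / x) - PI)
  else if Rlt_dec 0 y then PI / 2
  else if Rlt_dec y 0 then - (PI / 2)
  else 0.

(** Principal branch of the logarithm (for [w <> 0]). *)
Definition Clog (w : C) : C := (ln (Cmod w), Carg w).

(** [prod_(k = 1)^(N - 1) (1 + z^(2^k))], equal to [1] for [N = 1]. *)
Definition prod_factor (N : nat) (z : C) : C :=
  fold_right Cmult (RtoC 1) (map (fun k => 1 + z ^ (2 ^ k))%C (seq 1 (N - 1))).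

Definition F_factor (alpha : R) (N : nat) (z : C) : C :=
  (z * prod_factor N z
     * (1 + z ^ (2 ^ N) + RtoC alpha * z ^ (2 ^ (N - 1)))
   / (1 + z ^ (2 ^ (N + 1))))%C.

Definition F (alpha : R) (N : nat) : C -> C :=
  hadamard (F_factor alpha N) (fun z => Clog (1 / (1 - z))%C).

Definition harmonic_of (h g : C -> C) (z : C) : C := (h z + Cconj (g z))%C.

Definition harmonic_on_disk (f : C -> C) : Prop :=
  exists h g : C -> C,
    analytic_on_disk h /\ analytic_on_disk g /\
    forall z : C, unit_disk z -> f z = harmonic_of h g z.

Definition normalized (h g : C -> C) : Prop :=
  h (RtoC 0) = RtoC 0 /\ g (RtoC 0) = RtoC 0 /\ C_derive h (RtoC 0) = RtoC 1.

(** Since division is total, the quotient [g' / h'] only has its meaning where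
    [h'] does not vanish; this is part of the bound (a zero of [h'] that is not
    a zero of [g'] is a pole of the dilatation). *)
Definition dilatation_lt_1 (h g : C -> C) : Prop :=
  forall z : C, unit_disk z ->
    C_derive h z <> RtoC 0 /\ Cmod (C_derive g z / C_derive h z)%C < 1.

Definition partial_x (f : C -> C) (z : C) : C :=
  (Derive (fun x => Re (f (x, Im z))) (Re z),
   Derive (fun x => Im (f (x, Im z))) (Re z)).

Definition partial_y (f : C -> C) (z : C) : C :=
  (Derive (fun y => Re (f (Re z, y))) (Im z),
   Derive (fun y => Im (f (Re z, y))) (Im z)).

(** Wirtinger derivatives [f_z] and [f_(z bar)]. *)
Definition d_z (f : C -> C) (z : C) : C :=
  ((partial_x f z - Ci * partial_y f z) / 2)%C.

Definition d_zbar (f : C -> C) (z : C) : C :=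
  ((partial_x f z + Ci * partial_y f z) / 2)%C.

Definition jacobian (f : C -> C) (z : C) : R :=
  Cmod (d_z f z) ^ 2 - Cmod (d_zbar f z) ^ 2.

Definition sense_preserving (f : C -> C) : Prop :=
  forall z : C, unit_disk z -> 0 < jacobian f z.

Definition univalent (f : C -> C) : Prop :=
  forall u v : C, unit_disk u -> unit_disk v -> f u = f v -> u = v.

Definition locally_univalent (f : C -> C) : Prop :=
  forall z : C, unit_disk z ->
    exists r : R, 0 < r /\
      forall u v : C, unit_disk u -> unit_disk v ->
        Cmod (u - z)%C < r -> Cmod (v - z)%C < r -> f u = f v -> u = v.

Definition class_SH (f : C -> C) : Prop :=
  harmonic_on_disk f /\ sense_preserving f /\ univalent f /\
  f (RtoC 0) = RtoC 0 /\ d_z f (RtoC 0) = RtoC 1.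

(** Topological connectedness of a subset of the plane; the empty set is
    connected in this sense. *)
Definition C_connected (A : C -> Prop) : Prop :=
  forall U V : C -> Prop,
    open U -> open V ->
    (forall w, A w -> U w \/ V w) ->
    (exists w, A w /\ U w) -> (exists w, A w /\ V w) ->
    exists w, A w /\ U w /\ V w.

Definition convex_imaginary_direction (f : C -> C) : Prop :=
  forall c : R,
    C_connected (fun w => Re w = c /\ exists z, unit_disk z /\ f z = w).

(* Main.v *)
(** The Hadamard product with [log (1 / (1 - z)) = sum z^k / k] turns
    [F_factor] into a function with [F' = F_factor / z].  The product telescopes:
    with [w = z^(2^(N-1))],
    [(1 - z^2) F' = (1 - w^4 + alpha (w - w^3)) / (1 + w^4)],
    whose real part is positive already for [|alpha| <= 1].  So the convex
    combination [H = h + g] satisfies [Re ((1 - z^2) H') > 0], and [H'] is bounded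
    near [1] and [-1].  On each circular arc from [-1] to [1] the function
    [Re f = Re H] is then strictly increasing, with end limits common to all arcs,
    so each nonempty level curve [Re f = c] meets every arc exactly once.  Along
    such a curve, [Im f = Im (h - g)] is strictly monotone because the Jacobian of
    [f] is positive.  This gives injectivity, and identifies the image of [f] on
    the line [Re w = c] with the image of an interval. *)

Require Import Defs.
From Stdlib Require Import Reals Lra Lia List Arith Classical ClassicalEpsilon Ranalysis5.
From Coquelicot Require Import Coquelicot.

Open Scope R_scope.

(** * Complex power series *)

(** No end limit is computed and [H] is not extended to the boundary. The map q = (1 + z) / (1 - z)
    carries the disk to the right half-plane, -1 and 1 to 0 and infinity, and the arcs to the rays q
    = r (1 + i s). Up to a factor, 1 - z^2 is the velocity along the arcs, so the sign condition
    becomes monotonicity in r. At fixed r, the s-derivative of Re H is at most 2 B r / (1 + r)^2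
    wherever |H'| <= B. This tends to 0 at both ends, so values on two rays approach each other
    there, and the intermediate value theorem carries a level from one ray to every other. The bound
    B is local because F' can have poles on the unit circle, at the roots of z^(2^(N+1)) = -1; the
    points 1 and -1 stay clear of them. The derivative of [F] takes some work: [F] is given by
    Taylor coefficients, themselves iterated values of [C_derive], and [Clog] by real functions.
    Hence the termwise differentiation of power series and the Cauchy-Riemann criterion. *)

Notation is_Cderive := (@is_derive C_AbsRing C_NormedModule).

(** Balls and norms over [C_AbsRing] are both measured by [Cmod], so the filter definition unfolds
    to this estimate by conversion. *)
Lemma is_Cderive_eps (f : C -> C) (z l : C) :
  is_Cderive f z l <->
  forall eps, 0 < eps -> exists delta, 0 < delta /\
    forall w : C, Cmod (w - z)%C < delta ->
      Cmod (f w - f z - (w - z) * l)%C <= eps * Cmod (w - z)%C.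
Proof.
  split.
  - intros [_ H] eps He.
    destruct (H z (fun P HP => HP) (mkposreal eps He)) as [d Hd].
    exists d; split; [apply cond_pos|].
    intros w Hw. exact (Hd w Hw).
  - intros H; split.
    + apply is_linear_scal_l.
    + intros x Hx.
      rewrite <- (is_filter_lim_locally_unique _ _ Hx).
      intros eps.
      destruct (H eps (cond_pos eps)) as [d [Hd1 Hd]].
      exists (mkposreal d Hd1). intros w Hw. exact (Hd w Hw).
Qed.

Lemma is_Cderive_ext_disk (f g : C -> C) (z l : C) :
  unit_disk z -> (forall w, unit_disk w -> f w = g w) ->
  is_Cderive f z l -> is_Cderive g z l.
Proof.
  unfold unit_disk. intros Hz Hfg. rewrite !is_Cderive_eps.
  intros H eps He. destruct (H eps He) as [d [Hd Hf]].
  exists (Rmin d (1 - Cmod z)). split.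
  { apply Rmin_glb_lt; lra. }
  intros w Hw.
  assert (Hw1 := Rlt_le_trans _ _ _ Hw (Rmin_l _ _)).
  assert (Hw2 := Rlt_le_trans _ _ _ Hw (Rmin_r _ _)).
  assert (Hw3 : Cmod w < 1).
  { replace w with ((w - z) + z)%C by ring.
    apply Rle_lt_trans with (1 := Cmod_triangle _ _). lra. }
  rewrite <- !Hfg by assumption. apply Hf, Hw1.
Qed.

Lemma Im_le_Cmod (c : C) : Rabs (Im c) <= Cmod c.
Proof. apply Rle_trans with (2 := Rmax_Cmod c). apply Rmax_r. Qed.

Lemma Cmod_le_Re_Im (c : C) : Cmod c <= Rabs (Re c) + Rabs (Im c).
Proof.
  apply Rsqr_incr_0_var.
  2: { assert (H := Rabs_pos (Re c)); assert (H' := Rabs_pos (Im c)); lra. }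
  unfold Rsqr.
  replace (Cmod c * Cmod c) with (Re c ^ 2 + Im c ^ 2)
    by (rewrite <- Cmod2_alt; ring).
  rewrite <- (pow2_abs (Re c)), <- (pow2_abs (Im c)).
  assert (H := Rabs_pos (Re c)); assert (H' := Rabs_pos (Im c)). nra.
Qed.

(** * Absolutely convergent complex series *)

Definition abs_summable (u : nat -> C) : Prop := ex_series (fun k => Cmod (u k)).

Lemma abs_summable_le (u : nat -> C) (b : nat -> R) :
  (forall k, Cmod (u k) <= b k) -> ex_series b -> abs_summable u.
Proof.
  intros H Hb. apply (ex_series_le (V := R_CompleteNormedModule) _ b); [|exact Hb].
  intros k. change (Rabs (Cmod (u k)) <= b k).
  rewrite Rabs_pos_eq by apply Cmod_ge_0. apply H.
Qed.

Lemma abs_summable_Re (u : nat -> C) :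
  abs_summable u -> ex_series (fun k => Re (u k)).
Proof.
  intros H. apply (ex_series_le (V := R_CompleteNormedModule) _ _ (fun k => re_le_Cmod (u k)) H).
Qed.

Lemma abs_summable_Im (u : nat -> C) :
  abs_summable u -> ex_series (fun k => Im (u k)).
Proof.
  intros H. apply (ex_series_le (V := R_CompleteNormedModule) _ _ (fun k => Im_le_Cmod (u k)) H).
Qed.

Lemma abs_summable_plus (u v : nat -> C) :
  abs_summable u -> abs_summable v -> abs_summable (fun k => u k + v k)%C.
Proof.
  intros Hu Hv.
  apply (abs_summable_le _ _ (fun k => Cmod_triangle (u k) (v k))).
  exact (ex_series_plus _ _ Hu Hv).
Qed.

Lemma abs_summable_scal (c : C) (u : nat -> C) :
  abs_summable u -> abs_summable (fun k => c * u k)%C.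
Proof.
  intros Hu. apply abs_summable_le with (fun k => Cmod c * Cmod (u k)).
  - intros k; rewrite Cmod_mult; apply Rle_refl.
  - exact (ex_series_scal (Cmod c) _ Hu).
Qed.

Lemma CSeries_ext (u v : nat -> C) :
  (forall k, u k = v k) -> CSeries u = CSeries v.
Proof.
  intros H. unfold CSeries. f_equal; apply Series_ext; intros k; now rewrite H.
Qed.

Lemma CSeries_plus (u v : nat -> C) :
  abs_summable u -> abs_summable v ->
  CSeries (fun k => u k + v k)%C = (CSeries u + CSeries v)%C.
Proof.
  intros Hu Hv. unfold CSeries.
  apply injective_projections; simpl.
  - rewrite <- Series_plus by (now apply abs_summable_Re).
    apply Series_ext; intros; reflexivity.
  - rewrite <- Series_plus by (now apply abs_summable_Im).
    apply Series_ext; intros; reflexivity.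
Qed.

Lemma CSeries_scal (c : C) (u : nat -> C) :
  abs_summable u -> CSeries (fun k => c * u k)%C = (c * CSeries u)%C.
Proof.
  intros Hu.
  assert (H1 := abs_summable_Re _ Hu). assert (H2 := abs_summable_Im _ Hu).
  unfold CSeries. apply injective_projections; simpl.
  - rewrite <- !Series_scal_l.
    rewrite <- Series_minus.
    + apply Series_ext; intros; reflexivity.
    + exact (ex_series_scal (fst c) _ H1).
    + exact (ex_series_scal (snd c) _ H2).
  - rewrite <- !Series_scal_l.
    rewrite <- Series_plus.
    + apply Series_ext; intros; reflexivity.
    + exact (ex_series_scal (fst c) _ H2).
    + exact (ex_series_scal (snd c) _ H1).
Qed.

Lemma CSeries_incr_1 (u : nat -> C) :
  abs_summable u -> CSeries u = (u O + CSeries (fun k => u (S k)))%C.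
Proof.
  intros Hu. unfold CSeries.
  rewrite (Series_incr_1 _ (abs_summable_Re _ Hu)).
  rewrite (Series_incr_1 _ (abs_summable_Im _ Hu)).
  reflexivity.
Qed.

(** The factor 2 comes from bounding the real and imaginary sums separately. *)
Lemma Cmod_CSeries_le (u : nat -> C) :
  abs_summable u -> Cmod (CSeries u) <= 2 * Series (fun k => Cmod (u k)).
Proof.
  intros Hu. apply Rle_trans with (1 := Cmod_le_Re_Im _). simpl.
  assert (A : forall (p : C -> R), (forall c, Rabs (p c) <= Cmod c) ->
    Rabs (Series (fun k => p (u k))) <= Series (fun k => Cmod (u k))).
  { intros p Hp.
    apply Rle_trans with (Series (fun k => Rabs (p (u k)))).
    - apply Series_Rabs.
      apply (ex_series_le (V := R_CompleteNormedModule) _ (fun k => Cmod (u k))); [|exact Hu].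
      intros k. change (Rabs (Rabs (p (u k))) <= Cmod (u k)). rewrite Rabs_Rabsolu. apply Hp.
    - apply Series_le; [|exact Hu].
      intros k. split; [apply Rabs_pos|apply Hp]. }
  assert (A1 := A Re re_le_Cmod). assert (A2 := A Im Im_le_Cmod). lra.
Qed.

(** Radius of convergence at least [1]. *)
Definition tame (a : nat -> C) : Prop :=
  forall r, 0 <= r < 1 -> ex_series (fun k => Cmod (a k) * r ^ k).

Definition CPS (a : nat -> C) (z : C) : C := CSeries (fun k => a k * z ^ k)%C.

Definition has_ps (f : C -> C) (a : nat -> C) : Prop :=
  tame a /\ forall z, unit_disk z -> f z = CPS a z.

Definition dcoef (a : nat -> C) (k : nat) : C := (INR (S k) * a (S k))%C.

Lemma tame_abs_summable (a : nat -> C) (z : C) :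
  tame a -> unit_disk z -> abs_summable (fun k => a k * z ^ k)%C.
Proof.
  intros Ha Hz. apply abs_summable_le with (fun k => Cmod (a k) * Cmod z ^ k).
  - intros k. rewrite Cmod_mult, Cmod_pow. apply Rle_refl.
  - apply Ha. split; [apply Cmod_ge_0|exact Hz].
Qed.

Lemma tame_le (a b : nat -> C) :
  (forall k, Cmod (a k) <= Cmod (b k)) -> tame b -> tame a.
Proof.
  intros H Hb r Hr.
  apply (ex_series_le (V := R_CompleteNormedModule) _ (fun k => Cmod (b k) * r ^ k)).
  - intros k. change (Rabs (Cmod (a k) * r ^ k) <= Cmod (b k) * r ^ k).
    assert (0 <= r ^ k) by (apply pow_le; lra).
    rewrite Rabs_pos_eq.
    + apply Rmult_le_compat_r; auto.
    + apply Rmult_le_pos; auto. apply Cmod_ge_0.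
  - now apply Hb.
Qed.

Lemma tame_bounded (a : nat -> C) (B : R) : (forall k, Cmod (a k) <= B) -> tame a.
Proof.
  intros H r Hr.
  apply (ex_series_le (V := R_CompleteNormedModule) _ (fun k => B * r ^ k)).
  - intros k. change (Rabs (Cmod (a k) * r ^ k) <= B * r ^ k).
    assert (0 <= r ^ k) by (apply pow_le; lra).
    rewrite Rabs_pos_eq.
    + apply Rmult_le_compat_r; auto.
    + apply Rmult_le_pos; auto. apply Cmod_ge_0.
  - apply (ex_series_scal (V := R_NormedModule) B (fun k => r ^ k)).
    apply ex_series_geom. rewrite Rabs_pos_eq; lra.
Qed.

(** [CV_radius] is unchanged by differentiation, but convergence at [r] alone gives only a radius at
    least [r]; testing at a point between [r] and 1 makes it strictly larger. *)
Lemma tame_dcoef (a : nat -> C) : tame a -> tame (dcoef a).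
Proof.
  intros Ha r Hr.
  set (p := fun k => Cmod (a k)).
  assert (Hcv : Rbar_lt r (CV_radius p)).
  { set (r' := (1 + r) / 2).
    apply Rbar_lt_le_trans with r'; [simpl; unfold r'; lra|].
    apply Rbar_not_lt_le. intros Hlt.
    apply (CV_disk_outside p r').
    - rewrite Rabs_pos_eq; [exact Hlt|unfold r'; lra].
    - apply (ex_series_lim_0 (fun k => p k * r' ^ k)). apply Ha. unfold r'; lra. }
  rewrite <- CV_radius_derive in Hcv.
  rewrite <- (Rabs_pos_eq r) in Hcv by lra.
  apply CV_disk_inside in Hcv.
  eapply ex_series_ext; [|exact Hcv].
  intros k. simpl. unfold PS_derive, p, dcoef.
  rewrite Cmod_mult, Cmod_R, (Rabs_pos_eq (INR (S k))) by apply pos_INR.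
  apply Rabs_pos_eq.
  apply Rmult_le_pos; [|apply pow_le; lra].
  apply Rmult_le_pos; [apply pos_INR|apply Cmod_ge_0].
Qed.

(** The bound is shaped for summation: times [Cmod (a (S (S k)))] it is a term of the twice
    differentiated series at [rho]. In the induction the next remainder is [w] times the previous
    one plus a multiple of (w - z)^2. *)
Lemma Cpow_second_order (w z : C) (rho : R) (k : nat) :
  Cmod w <= rho -> Cmod z <= rho ->
  Cmod (w ^ (S (S k)) - z ^ (S (S k)) - (w - z) * (INR (S (S k)) * z ^ (S k)))%C
  <= INR (S (S k)) * INR (S k) * rho ^ k * (Cmod (w - z)%C * Cmod (w - z)%C).
Proof.
  intros Hw Hz. assert (Hr : 0 <= rho) by (apply Rle_trans with (2 := Hw); apply Cmod_ge_0).
  induction k as [|k IH].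
  - replace (w ^ 2 - z ^ 2 - (w - z) * (INR 2 * z ^ 1))%C with ((w - z) * (w - z))%C.
    + rewrite Cmod_mult. simpl. assert (H := Cmod_ge_0 (w - z)%C). nra.
    + simpl. rewrite RtoC_plus. ring.
  - replace (w ^ S (S (S k)) - z ^ S (S (S k)) - (w - z) * (INR (S (S (S k))) * z ^ S (S k)))%C
      with (w * (w ^ S (S k) - z ^ S (S k) - (w - z) * (INR (S (S k)) * z ^ S k))
            + INR (S (S k)) * z ^ S k * ((w - z) * (w - z)))%C.
    2: { rewrite (S_INR (S (S k))), RtoC_plus, !Cpow_S. ring. }
    apply Rle_trans with (1 := Cmod_triangle _ _).
    rewrite !Cmod_mult, Cmod_R, Cmod_pow, (Rabs_pos_eq (INR _)) by apply pos_INR.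
    set (d := Cmod (w - z)%C) in *. set (D := Cmod (_ - _ - _)%C) in *.
    assert (Hd : 0 <= d) by apply Cmod_ge_0.
    assert (HD : 0 <= D) by apply Cmod_ge_0.
    assert (Hp : Cmod z ^ S k <= rho ^ S k).
    { apply pow_incr. split; [apply Cmod_ge_0|exact Hz]. }
    assert (Hp' : 0 <= rho ^ k) by now apply pow_le.
    assert (HI := pos_INR (S k)).
    rewrite (S_INR (S (S k))), (S_INR (S k)) in *. set (n := INR (S k)) in *.
    assert (E1 : Cmod w * D <= rho * ((n + 1) * n * rho ^ k * (d * d))).
    { apply Rmult_le_compat; auto. apply Cmod_ge_0. }
    assert (E2 : (n + 1) * Cmod z ^ S k * (d * d) <= (n + 1) * rho ^ S k * (d * d)).
    { apply Rmult_le_compat_r; [nra|]. apply Rmult_le_compat_l; [lra|exact Hp]. }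
    apply Rle_trans with (1 := Rplus_le_compat _ _ _ _ E1 E2).
    simpl.
    assert (E3 : 0 <= (n + 1) * (rho * rho ^ k) * (d * d)).
    { apply Rmult_le_pos; [|nra]. apply Rmult_le_pos; [lra|].
      now apply Rmult_le_pos. }
    nra.
Qed.

(** Summing the quadratic remainders termwise leaves an error of at most B |w - z|^2, where B is
    taken at a radius [rho] between |z| and 1 and serves all w in that smaller disk. *)
Lemma is_Cderive_CPS (a : nat -> C) (z : C) :
  tame a -> unit_disk z -> is_Cderive (CPS a) z (CPS (dcoef a) z).
Proof.
  intros Ha Hz. apply is_Cderive_eps. intros eps He.
  set (rho := (1 + Cmod z) / 2).
  assert (Hz0 := Cmod_ge_0 z). unfold unit_disk in Hz.
  assert (Hrho : 0 <= rho < 1 /\ Cmod z < rho) by (unfold rho; lra).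
  assert (Hda := tame_dcoef _ Ha). assert (Hdda := tame_dcoef _ Hda).
  assert (Hs := Hdda rho (proj1 Hrho)).
  set (B := 2 * Series (fun k => Cmod (dcoef (dcoef a) k) * rho ^ k)).
  assert (HB : 0 <= B).
  { apply Rmult_le_pos; [lra|].
    replace 0 with (Series (fun k => 0 * (Cmod (dcoef (dcoef a) k) * rho ^ k)))
      by (rewrite Series_scal_l; ring).
    apply Series_le; [|exact Hs]. intros k.
    assert (0 <= Cmod (dcoef (dcoef a) k) * rho ^ k); [|lra].
    apply Rmult_le_pos; [apply Cmod_ge_0|apply pow_le; lra]. }
  exists (Rmin (rho - Cmod z) (eps / (B + 1))).
  assert (HeB : 0 < eps / (B + 1)) by (apply Rdiv_lt_0_compat; lra).
  split. { apply Rmin_glb_lt; lra. }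
  intros w Hw.
  assert (Hw1 := Rlt_le_trans _ _ _ Hw (Rmin_l _ _)).
  assert (Hw2 := Rlt_le_trans _ _ _ Hw (Rmin_r _ _)).
  assert (Hwr : Cmod w < rho).
  { replace w with ((w - z) + z)%C by ring.
    apply Rle_lt_trans with (1 := Cmod_triangle _ _). lra. }
  assert (Hwd : unit_disk w) by (unfold unit_disk; lra).
  assert (Sw := tame_abs_summable _ _ Ha Hwd).
  assert (Sz := tame_abs_summable _ _ Ha Hz).
  assert (Sd := tame_abs_summable _ _ Hda Hz).
  (* The remainder of the term of degree k + 1. It vanishes for k = 0 and the constant terms cancel,
     so the sum starts in degree 2. *)
  set (u := fun k => (a (S k) * (w ^ S k - z ^ S k - (w - z) * (INR (S k) * z ^ k)))%C).
  assert (Hu : forall k, Cmod (u (S k)) <=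
     Cmod (dcoef (dcoef a) k) * rho ^ k * (Cmod (w - z)%C * Cmod (w - z)%C)).
  { intros k. unfold u, dcoef. rewrite !Cmod_mult, !Cmod_R, !(Rabs_pos_eq (INR _)) by apply pos_INR.
    assert (H := Cpow_second_order w z rho k (Rlt_le _ _ Hwr) (Rlt_le _ _ (proj2 Hrho))).
    apply Rle_trans with (1 := Rmult_le_compat_l _ _ _ (Cmod_ge_0 (a (S (S k)))) H).
    apply Req_le. ring. }
  assert (Hbs : ex_series (fun k => Cmod (dcoef (dcoef a) k) * rho ^ k * (Cmod (w - z)%C * Cmod (w - z)%C))).
  { apply (ex_series_scal_r (Cmod (w - z)%C * Cmod (w - z)%C) _ Hs). }
  assert (SuS := abs_summable_le _ _ Hu Hbs).
  assert (Su : abs_summable u).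
  { apply (ex_series_incr_1 (fun k => Cmod (u k))). exact SuS. }
  assert (E : (CPS a w - CPS a z - (w - z) * CPS (dcoef a) z)%C = CSeries (fun k => u (S k))).
  { assert (u0 : u O = 0%C) by (unfold u; simpl; ring).
    assert (E0 : CSeries u = CSeries (fun k => u (S k))).
    { rewrite (CSeries_incr_1 _ Su), u0. ring. }
    rewrite <- E0. unfold CPS.
    rewrite (CSeries_incr_1 _ Sw), (CSeries_incr_1 _ Sz).
    replace (a O * w ^ 0)%C with (a O * z ^ 0)%C by (simpl; ring).
    assert (Sw' : abs_summable (fun k => a (S k) * w ^ S k)%C).
    { apply (ex_series_incr_1 (fun k => Cmod (a k * w ^ k)%C)). exact Sw. }
    assert (Sz' : abs_summable (fun k => a (S k) * z ^ S k)%C).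
    { apply (ex_series_incr_1 (fun k => Cmod (a k * z ^ k)%C)). exact Sz. }
    transitivity (CSeries (fun k => (a (S k) * w ^ S k) + ((- (1)) * (a (S k) * z ^ S k) +
       (- (w - z)) * (dcoef a k * z ^ k)))%C).
    - rewrite CSeries_plus; [|exact Sw'|].
      rewrite CSeries_plus, !CSeries_scal; auto.
      + ring.
      + now apply abs_summable_scal.
      + now apply abs_summable_scal.
      + apply abs_summable_plus; now apply abs_summable_scal.
    - apply CSeries_ext. intros k. unfold u, dcoef. ring. }
  rewrite E. apply Rle_trans with (1 := Cmod_CSeries_le _ SuS).
  assert (Hle : Series (fun k => Cmod (u (S k))) <=
     Series (fun k => Cmod (dcoef (dcoef a) k) * rho ^ k) * (Cmod (w - z)%C * Cmod (w - z)%C)).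
  { rewrite <- Series_scal_r. apply Series_le; [|exact Hbs].
    intros k. split; [apply Cmod_ge_0|apply Hu]. }
  set (d := Cmod (w - z)%C) in *.
  assert (Hd : 0 <= d) by apply Cmod_ge_0.
  assert (Hd' : d * (B + 1) <= eps).
  { apply Rmult_lt_compat_r with (r := B + 1) in Hw2; [|lra].
    unfold Rdiv in Hw2. rewrite Rmult_assoc, Rinv_l in Hw2; lra. }
  apply Rle_trans with (B * (d * d)). { unfold B. lra. }
  nra.
Qed.

(** Taking the extra derivative first, instead of last as in the definition, lets an induction on
    [k] pass to the power series of [C_derive f]. *)
Lemma C_derive_n_S (f : C -> C) (k : nat) :
  C_derive_n f (S k) = C_derive_n (C_derive f) k.
Proof. induction k as [|k IH]; simpl; [reflexivity|]. now rewrite <- IH. Qed.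

Lemma has_ps_is_Cderive (f : C -> C) (a : nat -> C) (z : C) :
  has_ps f a -> unit_disk z -> is_Cderive f z (CPS (dcoef a) z).
Proof.
  intros [Ha Hf] Hz.
  apply is_Cderive_ext_disk with (CPS a); auto.
  - intros w Hw. symmetry; auto.
  - now apply is_Cderive_CPS.
Qed.

Lemma has_ps_C_derive (f : C -> C) (a : nat -> C) :
  has_ps f a -> has_ps (C_derive f) (dcoef a).
Proof.
  intros H. split.
  - apply tame_dcoef, H.
  - intros z Hz. apply is_C_derive_unique. now apply has_ps_is_Cderive.
Qed.

Lemma unit_disk_0 : unit_disk 0.
Proof. unfold unit_disk. rewrite Cmod_0. lra. Qed.

Lemma has_ps_at_0 (f : C -> C) (a : nat -> C) : has_ps f a -> f 0 = a O.
Proof.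
  intros [Ha Hf]. rewrite (Hf _ unit_disk_0). unfold CPS.
  rewrite CSeries_incr_1 by (now apply tame_abs_summable, unit_disk_0).
  rewrite (CSeries_ext _ (fun k => 0 * (a (S k) * 0 ^ k))%C).
  - rewrite CSeries_scal; [simpl; ring|].
    eapply (tame_abs_summable (fun k => a (S k))); [|exact unit_disk_0].
    apply tame_le with (dcoef a); [|now apply tame_dcoef].
    intros k. unfold dcoef. rewrite Cmod_mult, Cmod_R, Rabs_pos_eq by apply pos_INR.
    assert (H := Cmod_ge_0 (a (S k))). rewrite S_INR. assert (H' := pos_INR k). nra.
  - intros k. rewrite Cpow_S. ring.
Qed.

(** [has_ps] is inherited by the derivative on the disk, so k differentiations followed by
    evaluation at 0 isolate one coefficient. *)
Lemma taylor_coeff_has_ps (f : C -> C) (a : nat -> C) (k : nat) :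
  has_ps f a -> taylor_coeff f k = a k.
Proof.
  intros H. unfold taylor_coeff.
  assert (G : C_derive_n f k 0 = (INR (fact k) * a k)%C).
  { revert f a H. induction k as [|k IH]; intros f a H.
    - simpl. rewrite (has_ps_at_0 _ _ H). ring.
    - rewrite C_derive_n_S, (IH _ _ (has_ps_C_derive _ _ H)).
      unfold dcoef. rewrite fact_simpl, mult_INR, RtoC_mult. ring. }
  rewrite G. field. intros E. apply RtoC_inj in E. now apply INR_fact_neq_0 in E.
Qed.

(** * Cauchy-Riemann equations and the logarithm *)

Lemma differentiable_pt_lim_fst (x y : R) : differentiable_pt_lim (fun u _ => u) x y 1 0.
Proof. apply differentiable_pt_lim_proj1_0, derivable_pt_lim_id. Qed.

Lemma differentiable_pt_lim_snd (x y : R) : differentiable_pt_lim (fun _ v => v) x y 0 1.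
Proof.
  intros eps. exists (mkposreal 1 Rlt_0_1). intros u v _ _.
  replace (v - y - (0 * (u - x) + 1 * (v - y))) with 0 by ring.
  rewrite Rabs_R0. apply Rmult_le_pos; [left; apply cond_pos|].
  apply Rle_trans with (2 := Rmax_l _ _), Rabs_pos.
Qed.

Lemma differentiable_pt_lim_const (c x y : R) : differentiable_pt_lim (fun _ _ => c) x y 0 0.
Proof. apply differentiable_pt_lim_proj1_0, derivable_pt_lim_const. Qed.

Lemma differentiable_pt_lim_comp1 (g : R -> R) (f : R -> R -> R) (x y l lx ly : R) :
  derivable_pt_lim g (f x y) l -> differentiable_pt_lim f x y lx ly ->
  differentiable_pt_lim (fun u v => g (f u v)) x y (l * lx) (l * ly).
Proof.
  intros Hg Hf.
  assert (H := differentiable_pt_lim_comp (fun u _ => g u) f (fun _ _ => 0) x y l 0 lx ly 0 0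
    (differentiable_pt_lim_proj1_0 g (f x y) 0 l Hg) Hf (differentiable_pt_lim_const 0 x y)).
  rewrite !Rmult_0_l, !Rplus_0_r in H. exact H.
Qed.

Lemma differentiable_pt_lim_plus (f g : R -> R -> R) (x y fx fy gx gy : R) :
  differentiable_pt_lim f x y fx fy -> differentiable_pt_lim g x y gx gy ->
  differentiable_pt_lim (fun u v => f u v + g u v) x y (fx + gx) (fy + gy).
Proof.
  intros Hf Hg.
  replace (fx + gx) with (1 * fx + 1 * gx) by ring.
  replace (fy + gy) with (1 * fy + 1 * gy) by ring.
  apply (differentiable_pt_lim_comp (fun u v => u + v)); [|assumption|assumption].
  intros eps. exists (mkposreal 1 Rlt_0_1). intros u v _ _.
  replace (_ - _ - _) with 0 by ring.
  rewrite Rabs_R0. apply Rmult_le_pos; [left; apply cond_pos|].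
  apply Rle_trans with (2 := Rmax_l _ _), Rabs_pos.
Qed.

Lemma differentiable_pt_lim_mult (f g : R -> R -> R) (x y fx fy gx gy : R) :
  differentiable_pt_lim f x y fx fy -> differentiable_pt_lim g x y gx gy ->
  differentiable_pt_lim (fun u v => f u v * g u v) x y
    (fx * g x y + f x y * gx) (fy * g x y + f x y * gy).
Proof.
  intros Hf Hg.
  replace (fx * g x y + f x y * gx) with (g x y * fx + f x y * gx) by ring.
  replace (fy * g x y + f x y * gy) with (g x y * fy + f x y * gy) by ring.
  apply (differentiable_pt_lim_comp (fun u v => u * v)); [|assumption|assumption].
  (* The remainder is exactly the product of the two increments, so [eps] itself serves as the
     radius. *)
  intros eps. exists eps. intros u v Hu Hv.
  replace (u * v - f x y * g x y - (g x y * (u - f x y) + f x y * (v - g x y)))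
    with ((u - f x y) * (v - g x y)) by ring.
  rewrite Rabs_mult. apply Rmult_le_compat; try apply Rabs_pos; [lra|apply Rmax_r].
Qed.

Lemma differentiable_pt_lim_eq (f g : R -> R -> R) (x y fx fy gx gy : R) :
  (forall u v, f u v = g u v) -> fx = gx -> fy = gy ->
  differentiable_pt_lim f x y fx fy -> differentiable_pt_lim g x y gx gy.
Proof.
  intros H -> -> Hf. apply differentiable_pt_lim_ext with f; [|exact Hf].
  exists (mkposreal 1 Rlt_0_1). intros; apply H.
Qed.

Lemma Cmod_pair_bounds (a b : R) :
  Rmax (Rabs a) (Rabs b) <= Cmod (a, b) <= 2 * Rmax (Rabs a) (Rabs b).
Proof.
  split; [apply (Rmax_Cmod (a, b))|].
  apply Rle_trans with (1 := Cmod_le_Re_Im (a, b)). simpl.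
  assert (H1 := Rmax_l (Rabs a) (Rabs b)). assert (H2 := Rmax_r (Rabs a) (Rabs b)). lra.
Qed.

Lemma is_Cderive_differentiable (f : C -> C) (x y : R) (l : C) :
  is_Cderive f (x, y) l ->
  differentiable_pt_lim (fun u v => Re (f (u, v))) x y (Re l) (- Im l) /\
  differentiable_pt_lim (fun u v => Im (f (u, v))) x y (Im l) (Re l).
Proof.
  rewrite is_Cderive_eps. intros H.
  assert (A : forall eps : posreal, locally_2d (fun u v =>
     Cmod (f (u, v) - f (x, y) - ((u, v) - (x, y)) * l)%C <=
     eps * Rmax (Rabs (u - x)) (Rabs (v - y))) x y).
  { intros eps. destruct (H (eps / 2)) as [d [Hd Hf]]. { apply is_pos_div_2. }
    exists (mkposreal (d / 2) (is_pos_div_2 (mkposreal d Hd))). simpl. intros u v Hu Hv.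
    destruct (Cmod_pair_bounds (u - x) (v - y)) as [B1 B2].
    assert (B3 : Rmax (Rabs (u - x)) (Rabs (v - y)) < d / 2) by now apply Rmax_lub_lt.
    assert (E : ((u, v) - (x, y))%C = (u - x, v - y)) by reflexivity.
    specialize (Hf (u, v)). rewrite E in *.
    apply Rle_trans with (1 := Hf ltac:(lra)).
    assert (He := cond_pos eps). nra. }
  split; intros eps; destruct (A eps) as [d Hd]; exists d; intros u v Hu Hv;
    refine (Rle_trans _ _ _ _ (Hd u v Hu Hv)).
  - eapply Rle_trans; [|apply re_le_Cmod]. apply Req_le. f_equal. simpl.
    unfold Re, Im, Rminus. ring.
  - eapply Rle_trans; [|apply Im_le_Cmod]. apply Req_le. f_equal. simpl.
    unfold Re, Im, Rminus. ring.
Qed.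

(** [Cmod] is at most the sum of the absolute values of both components, so each component is
    allotted half of [eps]. *)
Lemma Cauchy_Riemann_is_Cderive (f : C -> C) (x y p q : R) :
  differentiable_pt_lim (fun u v => Re (f (u, v))) x y p (- q) ->
  differentiable_pt_lim (fun u v => Im (f (u, v))) x y q p ->
  is_Cderive f (x, y) (p, q).
Proof.
  intros H1 H2. apply is_Cderive_eps. intros eps He.
  set (e2 := mkposreal (eps / 2) (is_pos_div_2 (mkposreal eps He))).
  destruct (H1 e2) as [d1 Hd1]. destruct (H2 e2) as [d2 Hd2]. simpl in Hd1, Hd2.
  exists (Rmin d1 d2). split; [apply Rmin_glb_lt; apply cond_pos|].
  intros [u v] Hw.
  assert (E : ((u, v) - (x, y))%C = (u - x, v - y)) by reflexivity.
  rewrite E in *. destruct (Cmod_pair_bounds (u - x) (v - y)) as [B1 _].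
  assert (C1 := Rmin_l d1 d2). assert (C2 := Rmin_r d1 d2).
  assert (D1 := Rmax_l (Rabs (u - x)) (Rabs (v - y))).
  assert (D2 := Rmax_r (Rabs (u - x)) (Rabs (v - y))).
  specialize (Hd1 u v ltac:(lra) ltac:(lra)). specialize (Hd2 u v ltac:(lra) ltac:(lra)).
  apply Rle_trans with (1 := Cmod_le_Re_Im _).
  replace (Re (f (u, v) - f (x, y) - ((u - x)%R, (v - y)%R) * (p, q))%C)
    with (Re (f (u, v)) - Re (f (x, y)) - (p * (u - x) + - q * (v - y)))
    by (simpl; unfold Re; ring).
  replace (Im (f (u, v) - f (x, y) - ((u - x)%R, (v - y)%R) * (p, q))%C)
    with (Im (f (u, v)) - Im (f (x, y)) - (q * (u - x) + p * (v - y)))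
    by (simpl; unfold Im; ring).
  nra.
Qed.

Lemma unit_disk_Re (z : C) : unit_disk z -> -1 < Re z < 1.
Proof.
  intros H. assert (H' := re_le_Cmod z). unfold unit_disk in H.
  destruct (Rabs_def2 (Re z) 1); lra.
Qed.

(** For x < 1 the quotient has positive real part, so [Carg] stays in its first branch and the
    logarithm splits into two smooth real expressions. *)
Lemma Clog_geometric (x y : R) : x < 1 ->
  Clog (1 / (1 - (x, y)))%C =
  (- (1 / 2) * ln ((1 - x) * (1 - x) + y * y), atan (y * / (1 - x))).
Proof.
  intros Hx.
  set (D := (1 - x) * (1 - x) + y * y).
  assert (HD : 0 < D) by (unfold D; nra).
  assert (E : (1 / (1 - (x, y)))%C = ((1 - x) / D, y / D)).
  { unfold D in *. apply injective_projections; simpl; field; simpl; lra. }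
  rewrite E. unfold Clog. f_equal.
  - assert (HC : Cmod ((1 - x) / D, y / D) = sqrt (/ D)).
    { unfold Cmod. simpl. f_equal. unfold D in *. field. lra. }
    rewrite HC, <- Rpower_sqrt by (now apply Rinv_0_lt_compat).
    unfold Rpower. rewrite ln_exp, ln_Rinv by exact HD. field.
  - unfold Carg. simpl.
    destruct (Rlt_dec 0 ((1 - x) / D)) as [_|N].
    + f_equal. field. lra.
    + exfalso. apply N. apply Rdiv_lt_0_compat; lra.
Qed.

Lemma is_Cderive_Clog_geometric (z : C) : unit_disk z ->
  is_Cderive (fun z => Clog (1 / (1 - z)))%C z (1 / (1 - z))%C.
Proof.
  intros Hz.
  apply is_Cderive_ext_disk with
    (fun z => (- (1 / 2) * ln ((1 - fst z) * (1 - fst z) + snd z * snd z), atan (snd z * / (1 - fst z)))).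
  { exact Hz. }
  { intros [u v] Hw. symmetry. apply Clog_geometric. apply (unit_disk_Re _ Hw). }
  destruct z as [x y].
  assert (Hx := unit_disk_Re _ Hz). simpl in Hx.
  set (D := (1 - x) * (1 - x) + y * y).
  assert (HD : 0 < D) by (unfold D; nra).
  replace (1 / (1 - (x, y)))%C with ((1 - x) / D, y / D).
  2: { unfold D in *. apply injective_projections; simpl; field; simpl; lra. }
  assert (Hu : differentiable_pt_lim (fun u v => 1 - u) x y (-1) 0).
  { assert (H := differentiable_pt_lim_comp1 (fun u => 1 - u) (fun u _ => u) x y (-1) 1 0).
    eapply differentiable_pt_lim_eq; [| | |apply H; [|apply differentiable_pt_lim_fst]].
    1-3: intros; simpl; ring.
    apply is_derive_Reals. auto_derive; [trivial|ring]. }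
  assert (Hv := differentiable_pt_lim_snd x y).
  apply Cauchy_Riemann_is_Cderive; simpl.
  - assert (H := differentiable_pt_lim_comp1 (fun u => - (1 / 2) * ln u)
      (fun u v => (1 - u) * (1 - u) + v * v) x y (- / (2 * D)) (- 2 * (1 - x)) (2 * y)).
    eapply differentiable_pt_lim_eq; [| | |apply H].
    + reflexivity.
    + field. lra.
    + field. lra.
    + apply is_derive_Reals. fold D. auto_derive; [exact HD|field; lra].
    + eapply differentiable_pt_lim_eq;
        [| | |exact (differentiable_pt_lim_plus _ _ _ _ _ _ _ _
           (differentiable_pt_lim_mult _ _ _ _ _ _ _ _ Hu Hu)
           (differentiable_pt_lim_mult _ _ _ _ _ _ _ _ Hv Hv))]; intros; simpl; ring.
  - assert (H := differentiable_pt_lim_comp1 atan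
      (fun u v => v * / (1 - u)) x y ((1 - x) * (1 - x) / D) (y / ((1 - x) * (1 - x))) (/ (1 - x))).
    assert (Hi : differentiable_pt_lim (fun u v => / (1 - u)) x y (/ ((1 - x) * (1 - x))) 0).
    { assert (H' := differentiable_pt_lim_comp1 Rinv (fun u v => 1 - u) x y (- / ((1 - x) * (1 - x))) (-1) 0).
      eapply differentiable_pt_lim_eq; [| | |eapply H'; [|exact Hu]].
      - reflexivity.
      - ring.
      - ring.
      - apply is_derive_Reals. auto_derive; [lra|field; lra]. }
    eapply differentiable_pt_lim_eq; [| | |apply H].
    + reflexivity.
    + field. split; lra.
    + field. split; lra.
    + apply is_derive_Reals. auto_derive; [trivial|].
      unfold D in *. field. repeat split; lra.
    + eapply differentiable_pt_lim_eq;
        [| | |exact (differentiable_pt_lim_mult _ _ _ _ _ _ _ _ Hv Hi)]; [reflexivity|simpl; field; lra|simpl; field; lra].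
Qed.

(** * The derivative of [F] *)

Lemma has_ps_ext (f g : C -> C) (a : nat -> C) :
  (forall z, unit_disk z -> f z = g z) -> has_ps f a -> has_ps g a.
Proof.
  intros H [Ha Hf]. split; [exact Ha|]. intros z Hz. rewrite <- H; auto.
Qed.

Lemma has_ps_plus (f g : C -> C) (a b : nat -> C) :
  has_ps f a -> has_ps g b -> has_ps (fun z => f z + g z)%C (fun k => a k + b k)%C.
Proof.
  intros [Ha Hf] [Hb Hg]. split.
  - intros r Hr.
    apply (ex_series_le (V := R_CompleteNormedModule) _
      (fun k => Cmod (a k) * r ^ k + Cmod (b k) * r ^ k)).
    + intros k. change (Rabs (Cmod (a k + b k)%C * r ^ k) <= Cmod (a k) * r ^ k + Cmod (b k) * r ^ k).
      assert (H : 0 <= r ^ k) by (apply pow_le; lra).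
      rewrite Rabs_pos_eq by (apply Rmult_le_pos; auto; apply Cmod_ge_0).
      rewrite <- Rmult_plus_distr_r.
      apply Rmult_le_compat_r; auto. apply Cmod_triangle.
    + exact (ex_series_plus _ _ (Ha r Hr) (Hb r Hr)).
  - intros z Hz. rewrite (Hf z Hz), (Hg z Hz). unfold CPS.
    rewrite <- CSeries_plus by (now apply tame_abs_summable).
    apply CSeries_ext. intros; ring.
Qed.

Lemma has_ps_scal (c : C) (f : C -> C) (a : nat -> C) :
  has_ps f a -> has_ps (fun z => c * f z)%C (fun k => c * a k)%C.
Proof.
  intros [Ha Hf]. split.
  - intros r Hr.
    apply ex_series_ext with (fun k => Cmod c * (Cmod (a k) * r ^ k)).
    { intros k. rewrite Cmod_mult. symmetry; apply Rmult_assoc. }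
    exact (ex_series_scal (Cmod c) _ (Ha r Hr)).
  - intros z Hz. rewrite (Hf z Hz). unfold CPS.
    rewrite <- CSeries_scal by (now apply tame_abs_summable).
    apply CSeries_ext. intros; ring.
Qed.

Definition Cincr_1 (a : nat -> C) (k : nat) : C :=
  match k with O => 0%C | S k => a k end.

Lemma has_ps_mult_z (f : C -> C) (a : nat -> C) :
  has_ps f a -> has_ps (fun z => z * f z)%C (Cincr_1 a).
Proof.
  intros [Ha Hf].
  assert (T : tame (Cincr_1 a)).
  { intros r Hr. apply ex_series_incr_1. simpl.
    apply ex_series_ext with (fun k => r * (Cmod (a k) * r ^ k)).
    { intros k. change (r * (Cmod (a k) * r ^ k) = Cmod (a k) * (r * r ^ k)). ring. }
    exact (ex_series_scal r _ (Ha r Hr)). }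
  split; [exact T|].
  intros z Hz. rewrite (Hf z Hz). unfold CPS.
  rewrite (CSeries_incr_1 (fun k => Cincr_1 a k * z ^ k)%C) by (now apply tame_abs_summable).
  rewrite <- CSeries_scal by (now apply tame_abs_summable).
  simpl Cincr_1. rewrite Cmult_0_l, Cplus_0_l.
  apply CSeries_ext. intros k. rewrite Cpow_S. ring.
Qed.

Lemma tame_shift (a : nat -> C) : tame a -> tame (fun k => a (S k)).
Proof.
  intros Ha. apply tame_le with (dcoef a); [|now apply tame_dcoef].
  intros k. unfold dcoef. rewrite Cmod_mult, Cmod_R, Rabs_pos_eq by apply pos_INR.
  assert (H := Cmod_ge_0 (a (S k))). rewrite S_INR. assert (H' := pos_INR k). nra.
Qed.

Lemma CPS_shift (a : nat -> C) (z : C) : tame a -> unit_disk z ->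
  CPS a z = (a O + z * CPS (fun k => a (S k)) z)%C.
Proof.
  intros Ha Hz. unfold CPS.
  rewrite CSeries_incr_1 by (now apply tame_abs_summable).
  rewrite <- CSeries_scal by (now apply (tame_abs_summable (fun k => a (S k))); [apply tame_shift|]).
  f_equal; [simpl; ring|]. apply CSeries_ext. intros k. rewrite Cpow_S. ring.
Qed.

Lemma CPS_vanishing (n : nat) (a : nat -> C) (z : C) :
  tame a -> unit_disk z -> (forall k, (k < n)%nat -> a k = 0) ->
  CPS a z = (z ^ n * CPS (fun k => a (n + k)%nat) z)%C.
Proof.
  intros Ha Hz. revert a Ha. induction n as [|n IH]; intros a Ha H.
  - simpl. rewrite Cmult_1_l. reflexivity.
  - rewrite (CPS_shift a z Ha Hz), H by lia.
    rewrite (IH (fun k => a (S k)) (tame_shift a Ha)) by (intros; apply H; lia).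
    rewrite Cpow_S. simpl. ring.
Qed.

Lemma Cpow_disk (z : C) (n : nat) : unit_disk z -> (0 < n)%nat -> unit_disk (z ^ n)%C.
Proof.
  intros Hz Hn. unfold unit_disk in *. rewrite Cmod_pow.
  apply pow_lt_1_compat; [|exact Hn]. split; [apply Cmod_ge_0|exact Hz].
Qed.

Lemma unit_disk_one_plus_neq_0 (w : C) : unit_disk w -> (1 + w)%C <> 0.
Proof.
  intros Hw E. assert (E' : w = (- (1))%C).
  { replace w with ((1 + w) - 1)%C by ring. rewrite E. ring. }
  unfold unit_disk in Hw. rewrite E', Cmod_m1 in Hw. lra.
Qed.

Definition alternating_coef (M k : nat) : C :=
  if Nat.eqb (k mod M) 0 then RtoC ((-1) ^ (k / M)) else 0%C.

(** The coefficients satisfy c(k + M) = - c(k) and vanish for 0 < k < M, so their sum S solves S = 1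
    - z^M S. *)
Lemma has_ps_inv_one_plus_pow (M : nat) : (0 < M)%nat ->
  has_ps (fun z => / (1 + z ^ M))%C (alternating_coef M).
Proof.
  intros HM. set (c := alternating_coef M).
  assert (Hc : tame c).
  { apply tame_bounded with 1. intros k. unfold c, alternating_coef.
    destruct (Nat.eqb _ _); [|rewrite Cmod_0; lra].
    rewrite Cmod_R, pow_1_abs. lra. }
  split; [exact Hc|]. intros z Hz.
  assert (Hne := unit_disk_one_plus_neq_0 _ (Cpow_disk z M Hz HM)).
  assert (E : CPS c z = (1 - z ^ M * CPS c z)%C).
  { rewrite (CPS_shift c z Hc Hz) at 1.
    (* One coefficient is already split off, so M - 1 vanishing ones remain before index M. *)
    rewrite (CPS_vanishing (pred M) (fun k => c (S k)) z (tame_shift c Hc) Hz).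
    2: { intros k Hk. unfold c, alternating_coef.
         rewrite Nat.mod_small by lia. reflexivity. }
    assert (Es : CPS (fun k => c (S (pred M + k))) z = (- (1) * CPS c z)%C).
    { unfold CPS. rewrite <- CSeries_scal by (now apply tame_abs_summable).
      apply CSeries_ext. intros k. replace (S (pred M + k)) with (k + 1 * M)%nat by lia.
      unfold c, alternating_coef.
      rewrite Nat.Div0.mod_add, Nat.div_add by lia.
      destruct (Nat.eqb _ _); [|ring].
      rewrite Nat.add_1_r. simpl. rewrite RtoC_mult.
      replace (RtoC (-1)) with (- (1))%C by (rewrite <- RtoC_opp; reflexivity). ring. }
    rewrite Es. unfold c at 1. unfold alternating_coef. rewrite Nat.Div0.mod_0_l. simpl.
    rewrite Nat.Div0.div_0_l. simpl.
    replace (z ^ M)%C with (z * z ^ pred M)%C by (rewrite <- Cpow_S; f_equal; lia). ring. }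
  transitivity (/ (1 + z ^ M) * (CPS c z + z ^ M * CPS c z))%C.
  - rewrite E at 1. ring.
  - field. exact Hne.
Qed.

Lemma ex_ps_mult_pow (f : C -> C) (n : nat) :
  (exists a, has_ps f a) -> exists a, has_ps (fun z => z ^ n * f z)%C a.
Proof.
  intros [a Ha]. induction n as [|n [b Hb]].
  - exists a. revert Ha. apply has_ps_ext. intros; simpl; ring.
  - exists (Cincr_1 b). apply has_ps_mult_z in Hb. revert Hb.
    apply has_ps_ext. intros; simpl; ring.
Qed.

Lemma ex_ps_mult_one_plus (f : C -> C) (n : nat) :
  (exists a, has_ps f a) -> exists a, has_ps (fun z => (1 + z ^ n) * f z)%C a.
Proof.
  intros Hf. destruct Hf as [a Ha]. destruct (ex_ps_mult_pow f n (ex_intro _ a Ha)) as [b Hb].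
  exists (fun k => a k + b k)%C.
  apply has_ps_ext with (2 := has_ps_plus _ _ _ _ Ha Hb). intros; ring.
Qed.

(** The factor [z] of [F_factor] is cancelled rather than divided out, so the value at 0 is the
    right one too. *)
Definition F_deriv (alpha : R) (N : nat) (z : C) : C :=
  (prod_factor N z
     * (1 + z ^ (2 ^ N) + RtoC alpha * z ^ (2 ^ (N - 1)))
   / (1 + z ^ (2 ^ (N + 1))))%C.

(** Apart from the reciprocal, every factor is made of monomials, so shifts, sums and scalings of
    coefficient sequences suffice and no Cauchy product is formed. *)
Lemma ex_ps_F_deriv (alpha : R) (N : nat) : exists d, has_ps (F_deriv alpha N) d.
Proof.
  assert (HM : (0 < 2 ^ (N + 1))%nat) by (apply Nat.neq_0_lt_0, Nat.pow_nonzero; lia).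
  set (f0 := fun z => (/ (1 + z ^ (2 ^ (N + 1))))%C).
  assert (H0 : exists a, has_ps f0 a) by (eexists; exact (has_ps_inv_one_plus_pow _ HM)).
  destruct (ex_ps_mult_one_plus f0 (2 ^ N) H0) as [a Ha].
  destruct (ex_ps_mult_pow f0 (2 ^ (N - 1)) H0) as [b Hb].
  assert (H1 := has_ps_plus _ _ _ _ Ha (has_ps_scal alpha _ _ Hb)).
  assert (G : forall f l, (exists a, has_ps f a) ->
    exists a, has_ps (fun z => fold_right Cmult 1 (map (fun k => 1 + z ^ (2 ^ k)) l) * f z)%C a).
  { intros f l Hf. induction l as [|k l IH].
    - destruct Hf as [c Hc]. exists c. revert Hc. apply has_ps_ext. intros; simpl; ring.
    - destruct (ex_ps_mult_one_plus _ (2 ^ k) IH) as [c Hc].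
      exists c. revert Hc. apply has_ps_ext. intros; simpl; ring. }
  destruct (G _ (seq 1 (N - 1)) (ex_intro _ _ H1)) as [c Hc].
  exists c. revert Hc. apply has_ps_ext. intros z _.
  unfold F_deriv, prod_factor, f0, Cdiv. ring.
Qed.

(** The derivative 1 / (1 - z) has all coefficients 1, and dividing its coefficient of degree k by k
    + 1 gives that of degree k + 1. Degree 0 is left out because the other Hadamard factor vanishes
    there. *)
Lemma taylor_coeff_log_S (k : nat) :
  taylor_coeff (fun z => Clog (1 / (1 - z)))%C (S k) = (/ INR (S k))%C.
Proof.
  set (L := (fun z => Clog (1 / (1 - z)))%C).
  assert (H : has_ps (C_derive L) (fun _ => 1%C)).
  { assert (T : tame (fun _ => 1%C)) by (apply tame_bounded with 1; intros; rewrite Cmod_1; lra).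
    split; [exact T|]. intros z Hz.
    transitivity (1 / (1 - z))%C.
    { apply is_C_derive_unique. exact (is_Cderive_Clog_geometric z Hz). }
    assert (E := CPS_shift _ z T Hz).
    assert (Hne : (1 - z)%C <> 0).
    { replace (1 - z)%C with (1 + - z)%C by ring. apply unit_disk_one_plus_neq_0.
      unfold unit_disk. now rewrite Cmod_opp. }
    assert (E' : ((1 - z) * CPS (fun _ => 1) z)%C = 1%C).
    { transitivity (CPS (fun _ => 1) z - z * CPS (fun _ => 1) z)%C; [ring|]. rewrite E at 1. ring. }
    rewrite <- E' at 1. field. exact Hne. }
  assert (G := taylor_coeff_has_ps _ _ k H). unfold taylor_coeff in *.
  rewrite C_derive_n_S.
  assert (Hk : RtoC (INR (fact k)) <> 0) by (intros E; apply RtoC_inj in E; now apply INR_fact_neq_0 in E).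
  assert (HS : RtoC (INR (S k)) <> 0).
  { intros E; apply RtoC_inj in E. apply (not_0_INR (S k)); [lia|exact E]. }
  rewrite fact_simpl, mult_INR, RtoC_mult.
  transitivity (C_derive_n (C_derive L) k 0 / INR (fact k) / INR (S k))%C.
  - field. auto.
  - rewrite G. field. exact HS.
Qed.

(** The Hadamard product puts d(k) / (k + 1) in degree k + 1, and termwise differentiation restores
    d(k). *)
Lemma is_Cderive_F (alpha : R) (N : nat) (z : C) :
  unit_disk z -> is_Cderive (F alpha N) z (F_deriv alpha N z).
Proof.
  intros Hz. destruct (ex_ps_F_deriv alpha N) as [d Hd].
  assert (Hfac : has_ps (F_factor alpha N) (Cincr_1 d)).
  { apply has_ps_ext with (2 := has_ps_mult_z _ _ Hd). intros w _.
    unfold F_deriv, F_factor, Cdiv. ring. }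
  set (e := fun k => (taylor_coeff (F_factor alpha N) k *
     taylor_coeff (fun z => Clog (1 / (1 - z))) k)%C).
  assert (He0 : e O = 0).
  { unfold e. rewrite (taylor_coeff_has_ps _ _ _ Hfac). simpl. ring. }
  assert (HeS : forall k, e (S k) = (d k / INR (S k))%C).
  { intros k. unfold e. rewrite (taylor_coeff_has_ps _ _ _ Hfac), taylor_coeff_log_S. reflexivity. }
  assert (HS : forall k, RtoC (INR (S k)) <> 0).
  { intros k E; apply RtoC_inj in E. apply (not_0_INR (S k)); [lia|exact E]. }
  assert (Te : tame e).
  { apply tame_le with (Cincr_1 d); [|apply Hfac].
    intros [|k].
    - rewrite He0. simpl. lra.
    - rewrite HeS, Cmod_div, Cmod_R, Rabs_pos_eq by (try apply pos_INR; apply HS).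
      simpl Cincr_1. assert (H1 : 1 <= INR (S k)) by (rewrite S_INR; assert (H := pos_INR k); lra).
      assert (H2 := Cmod_ge_0 (d k)).
      apply Rmult_le_reg_r with (INR (S k)); [lra|].
      unfold Rdiv. rewrite Rmult_assoc, Rinv_l by lra. nra. }
  assert (HF : has_ps (F alpha N) e).
  (* [hadamard] is by definition the series with coefficients [e]. *)
  { split; [exact Te|]. intros w _. reflexivity. }
  replace (F_deriv alpha N z) with (CPS (dcoef e) z).
  - now apply has_ps_is_Cderive.
  - rewrite (proj2 Hd z Hz). apply CSeries_ext. intros k. unfold dcoef. rewrite HeS. field. apply HS.
Qed.

(** * Level curves *)

Lemma derivable_pt_lim_continuity (f : R -> R) (x l : R) :
  derivable_pt_lim f x l -> continuity_pt f x.
Proof. intros H. apply derivable_continuous_pt. exists l. exact H. Qed.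

Lemma differentiable_pt_lim_slice_l (f : R -> R -> R) (x y lx ly : R) :
  differentiable_pt_lim f x y lx ly -> derivable_pt_lim (fun u => f u y) x lx.
Proof.
  intros H.
  replace lx with (lx * 1 + ly * 0) by ring.
  apply (derivable_pt_lim_comp_2d f (fun t => t) (fun _ => y)); [exact H| |].
  - apply derivable_pt_lim_id.
  - apply derivable_pt_lim_const.
Qed.

Lemma differentiable_pt_lim_slice_r (f : R -> R -> R) (x y lx ly : R) :
  differentiable_pt_lim f x y lx ly -> derivable_pt_lim (fun v => f x v) y ly.
Proof.
  intros H.
  replace ly with (lx * 0 + ly * 1) by ring.
  apply (derivable_pt_lim_comp_2d f (fun _ => x) (fun t => t)); [exact H| |].
  - apply derivable_pt_lim_const.
  - apply derivable_pt_lim_id.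
Qed.

(** [U] is only differentiable at the point and [phi] only continuous there. So the increment D of
    [phi] is first shown to be O(h); then lx D + ly h = o(|D| + |h|) is divided by lx h. *)
Lemma implicit_derivative (U : R -> R -> R) (phi : R -> R) (s lx ly : R) :
  differentiable_pt_lim U (phi s) s lx ly -> 0 < lx -> continuity_pt phi s ->
  (forall v, U (phi v) v = U (phi s) s) ->
  derivable_pt_lim phi s (- ly / lx).
Proof.
  intros HU Hlx Hphi Hlev eps Heps.
  set (A := 2 * Rabs ly / lx + 1).
  assert (HA : 1 <= A).
  { unfold A. assert (0 <= 2 * Rabs ly / lx); [|lra].
    apply Rdiv_le_0_compat; [|exact Hlx]. assert (H := Rabs_pos ly); lra. }
  (* The bound lx / 2 lets e |D| be absorbed, which yields |D| <= A |h|; the other bound then makes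
     e (|D| + |h|) at most eps / 2 times lx |h|. *)
  set (e := Rmin (lx / 2) (eps / 2 * lx / (A + 1))).
  assert (He : 0 < e).
  { apply Rmin_glb_lt; [lra|]. apply Rdiv_lt_0_compat; [|lra]. nra. }
  assert (He1 : e <= lx / 2) by apply Rmin_l.
  assert (He2 : e * (A + 1) <= eps / 2 * lx).
  { assert (H : e <= eps / 2 * lx / (A + 1)) by apply Rmin_r.
    apply Rmult_le_compat_r with (r := A + 1) in H; [|lra].
    replace (eps / 2 * lx / (A + 1) * (A + 1)) with (eps / 2 * lx) in H by (field; lra).
    exact H. }
  destruct (HU (mkposreal e He)) as [d Hd]. simpl in Hd.
  destruct (Hphi d (cond_pos d)) as [d' [Hd' Hc]].
  exists (mkposreal (Rmin d d') (Rmin_glb_lt _ _ _ (cond_pos d) Hd')).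
  simpl. intros h Hh Hhd.
  assert (Hh1 := Rlt_le_trans _ _ _ Hhd (Rmin_l _ _)).
  assert (Hh2 := Rlt_le_trans _ _ _ Hhd (Rmin_r _ _)).
  assert (Hph : Rabs (phi (s + h) - phi s) < d).
  { apply (Hc (s + h)). split.
    - split; [exact I|]. lra.
    - simpl. unfold R_dist. replace (s + h - s) with h by ring. exact Hh2. }
  specialize (Hd (phi (s + h)) (s + h) Hph).
  replace (s + h - s) with h in Hd by ring. specialize (Hd Hh1).
  rewrite Hlev in Hd.
  set (D := phi (s + h) - phi s) in *.
  replace (U (phi s) s - U (phi s) s - (lx * D + ly * h)) with (- (lx * D + ly * h)) in Hd by ring.
  rewrite Rabs_Ropp in Hd.
  assert (Hh0 : 0 < Rabs h) by now apply Rabs_pos_lt.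
  assert (HD0 := Rabs_pos D).
  assert (Hm : Rmax (Rabs D) (Rabs h) <= Rabs D + Rabs h).
  { apply Rmax_lub; lra. }
  assert (Hd2 : Rabs (lx * D + ly * h) <= e * (Rabs D + Rabs h)).
  { apply Rle_trans with (1 := Hd). apply Rmult_le_compat_l; lra. }
  assert (HDA : Rabs D <= A * Rabs h).
  { assert (H1 : lx * Rabs D <= Rabs (lx * D + ly * h) + Rabs ly * Rabs h).
    { rewrite <- (Rabs_pos_eq lx) at 1 by lra. rewrite <- !Rabs_mult.
      replace (lx * D) with ((lx * D + ly * h) + - (ly * h)) at 1 by ring.
      rewrite <- (Rabs_Ropp (ly * h)). apply Rabs_triang. }
    apply Rmult_le_reg_l with (lx / 2); [lra|].
    replace (lx / 2 * (A * Rabs h)) with (Rabs ly * Rabs h + lx / 2 * Rabs h)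
      by (unfold A; field; lra).
    nra. }
  assert (HDA' : Rabs (lx * D + ly * h) <= eps / 2 * lx * Rabs h) by nra.
  replace (D / h - - ly / lx) with ((lx * D + ly * h) / (lx * h)) by (field; split; lra).
  unfold Rdiv. rewrite Rabs_mult, Rabs_inv, Rabs_mult, (Rabs_pos_eq lx) by lra.
  apply Rmult_lt_reg_r with (lx * Rabs h); [nra|].
  rewrite Rmult_assoc, Rinv_l by nra. nra.
Qed.

(** If the open sets separated the image, the indicator [chi] along the curve would be locally
    constant yet take the values 0 and 1; the intermediate value theorem would then give it the
    value 1 / 2. *)
Lemma connected_line_image (psi : R -> R) (c : R) :
  continuity psi -> C_connected (fun w => exists s, w = (c, psi s)).
Proof.
  intros Hpsi P Q HP HQ Hcov [w1 [[s1 ->] H1]] [w2 [[s2 ->] H2]].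
  apply NNPP. intros Hno.
  assert (Hex : forall s, P (c, psi s) -> ~ Q (c, psi s)).
  { intros s Hs Hs'. apply Hno. exists (c, psi s). split; eauto. }
  set (chi := fun s => if excluded_middle_informative (P (c, psi s)) then 0 else 1).
  assert (Hloc : forall (O : C -> Prop) s, open O -> O (c, psi s) ->
    exists d, 0 < d /\ forall t, Rabs (t - s) < d -> O (c, psi t)).
  { intros O s HO Hs. destruct (HO _ Hs) as [e He].
    destruct (Hpsi s e (cond_pos e)) as [d [Hd Hc]].
    exists d. split; [exact Hd|]. intros t Ht. apply He. split; simpl.
    - apply ball_center.
    - destruct (Req_dec t s) as [->|Hne]; [apply ball_center|].
      apply (Hc t). split; [split; [exact I|congruence]|exact Ht]. }
  assert (Hchi : continuity chi).
  { intros s e He.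
    assert (G : exists d, 0 < d /\ forall t, Rabs (t - s) < d -> chi t = chi s).
    { destruct (Hcov (c, psi s) (ex_intro _ s eq_refl)) as [Hs|Hs].
      - destruct (Hloc P s HP Hs) as [d [Hd Hc]]. exists d. split; [exact Hd|].
        intros t Ht. assert (HPt := Hc t Ht). unfold chi.
        destruct (excluded_middle_informative _); [|contradiction].
        destruct (excluded_middle_informative _); [reflexivity|contradiction].
      - destruct (Hloc Q s HQ Hs) as [d [Hd Hc]]. exists d. split; [exact Hd|].
        intros t Ht. assert (HQt := Hc t Ht). unfold chi.
        destruct (excluded_middle_informative _) as [E|_]; [now elim (Hex t)|].
        destruct (excluded_middle_informative _) as [E|_]; [now elim (Hex s)|reflexivity]. }
    destruct G as [d [Hd Hc]]. exists d. split; [exact Hd|].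
    intros t [_ Ht]. simpl. unfold R_dist. rewrite (Hc t Ht), Rminus_diag, Rabs_R0. exact He. }
  assert (E1 : chi s1 = 0).
  { unfold chi. destruct (excluded_middle_informative _); [reflexivity|contradiction]. }
  assert (E2 : chi s2 = 1).
  { unfold chi. destruct (excluded_middle_informative _) as [E|_]; [now elim (Hex s2)|reflexivity]. }
  destruct (IVT_gen chi s1 s2 (1 / 2) Hchi) as [x [_ Hx]].
  { rewrite E1, E2, Rmin_left, Rmax_right; lra. }
  revert Hx. unfold chi. destruct (excluded_middle_informative _); lra.
Qed.

(** On the half-plane [r > 0], level sets of [U] are graphs [r = phi s] over the
    whole [s]-line: [U] increases in [r], and its suprema and infima along the
    lines [s = const] do not depend on [s]. *)
Record monotone_shear (U V Ux Uy Vx Vy : R -> R -> R) : Prop := {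
  shear_U : forall r s, 0 < r -> differentiable_pt_lim U r s (Ux r s) (Uy r s);
  shear_V : forall r s, 0 < r -> differentiable_pt_lim V r s (Vx r s) (Vy r s);
  shear_Ux : forall r s, 0 < r -> 0 < Ux r s;
  shear_jac : forall r s, 0 < r -> 0 < Ux r s * Vy r s - Uy r s * Vx r s;
  shear_infty : forall s1 s2 eps, 0 < eps -> exists M, 0 < M /\
    forall r, M <= r -> Rabs (U r s1 - U r s2) < eps;
  shear_zero : forall s1 s2 eps, 0 < eps -> exists M, 0 < M /\
    forall r, 0 < r <= M -> Rabs (U r s1 - U r s2) < eps }.

Lemma shear_increasing (U V Ux Uy Vx Vy : R -> R -> R) (s r1 r2 : R) :
  monotone_shear U V Ux Uy Vx Vy -> 0 < r1 -> r1 < r2 -> U r1 s < U r2 s.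
Proof.
  intros HS H1 H2.
  apply (incr_function (fun r => U r s) 0 p_infty (fun r => Ux r s)); simpl; auto.
  - intros r Hr _. apply is_derive_Reals.
    exact (differentiable_pt_lim_slice_l _ _ _ _ _ (shear_U _ _ _ _ _ _ HS r s Hr)).
  - intros r Hr _. exact (shear_Ux _ _ _ _ _ _ HS r s Hr).
Qed.

(** On the line [s1], [U] stays above c by at least e1 beyond r1 + 1 and below c by at least e0
    before r1 / 2. Near the ends the line [s2] differs from it by less than these gaps, so it takes
    values on both sides of c. *)
Lemma shear_level_set_full (U V Ux Uy Vx Vy : R -> R -> R) (c r1 s1 s2 : R) :
  monotone_shear U V Ux Uy Vx Vy -> 0 < r1 -> U r1 s1 = c ->
  exists r2, 0 < r2 /\ U r2 s2 = c.
Proof.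
  intros HS Hr1 Hc.
  set (e1 := U (r1 + 1) s1 - c). set (e0 := c - U (r1 / 2) s1).
  assert (He1 : 0 < e1).
  { unfold e1. rewrite <- Hc. assert (H := shear_increasing _ _ _ _ _ _ s1 r1 (r1 + 1) HS Hr1). lra. }
  assert (He0 : 0 < e0).
  { unfold e0. rewrite <- Hc. assert (H := shear_increasing _ _ _ _ _ _ s1 (r1 / 2) r1 HS). lra. }
  destruct (shear_infty _ _ _ _ _ _ HS s1 s2 e1 He1) as [M1 [HM1 HU1]].
  destruct (shear_zero _ _ _ _ _ _ HS s1 s2 e0 He0) as [M0 [HM0 HU0]].
  set (a := Rmin M0 (r1 / 2)). set (b := Rmax M1 (r1 + 1)).
  assert (Ha : 0 < a <= M0 /\ a <= r1 / 2).
  { unfold a. split; [split|]; [apply Rmin_glb_lt; lra|apply Rmin_l|apply Rmin_r]. }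
  assert (Hb : M1 <= b /\ r1 + 1 <= b) by (unfold b; split; [apply Rmax_l|apply Rmax_r]).
  assert (HUa : U a s2 < c).
  { assert (H := Rabs_def2 _ _ (HU0 a (proj1 Ha))).
    assert (H' : U a s1 <= U (r1 / 2) s1).
    { destruct (Req_dec a (r1 / 2)) as [->|Hne]; [lra|].
      left. apply (shear_increasing _ _ _ _ _ _ _ _ _ HS); lra. }
    unfold e0 in H. lra. }
  assert (HUb : c < U b s2).
  { assert (H := Rabs_def2 _ _ (HU1 b (proj1 Hb))).
    assert (H' : U (r1 + 1) s1 <= U b s1).
    { destruct (Req_dec b (r1 + 1)) as [->|Hne]; [lra|].
      left. apply (shear_increasing _ _ _ _ _ _ _ _ _ HS); lra. }
    unfold e1 in H. lra. }
  destruct (IVT_interv (fun r => U r s2 - c) a b) as [r [Hr1' Hr2]].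
  - intros r Hr. apply derivable_pt_lim_continuity with (Ux r s2).
    rewrite <- (Rminus_0_r (Ux r s2)).
    apply derivable_pt_lim_minus; [|apply derivable_pt_lim_const].
    apply (differentiable_pt_lim_slice_l _ _ _ _ _ (shear_U _ _ _ _ _ _ HS r s2 ltac:(lra))).
  - lra.
  - lra.
  - lra.
  - exists r. split; lra.
Qed.

(** Strict monotonicity in r makes the chosen point on each line unique, so [phi] parametrizes the
    whole level. *)
Lemma shear_level_curve (U V Ux Uy Vx Vy : R -> R -> R) (c r0 s0 : R) :
  monotone_shear U V Ux Uy Vx Vy -> 0 < r0 -> U r0 s0 = c ->
  exists phi : R -> R,
    (forall r s, (0 < r /\ U r s = c) <-> r = phi s) /\
    continuity (fun s => V (phi s) s) /\
    (forall s1 s2, s1 < s2 -> V (phi s1) s1 < V (phi s2) s2).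
Proof.
  intros HS Hr0 Hc.
  set (phi := fun s => proj1_sig (constructive_indefinite_description _
     (shear_level_set_full _ _ _ _ _ _ c r0 s0 s HS Hr0 Hc))).
  assert (Hphi : forall s, 0 < phi s /\ U (phi s) s = c).
  { intros s. unfold phi. destruct (constructive_indefinite_description _ _). assumption. }
  assert (Hmono := fun s r1 r2 => shear_increasing _ _ _ _ _ _ s r1 r2 HS).
  assert (Huniq : forall r s, 0 < r -> U r s = c -> r = phi s).
  { intros r s Hr HU. destruct (Hphi s) as [H1 H2].
    destruct (Rtotal_order r (phi s)) as [H|[H|H]]; [|exact H|].
    - specialize (Hmono s _ _ Hr H). lra.
    - specialize (Hmono s _ _ H1 H). lra. }
  assert (Hcont : continuity phi).
  { intros s eps Heps. destruct (Hphi s) as [H1 H2].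
    set (e := Rmin eps (phi s / 2)).
    assert (He : 0 < e /\ e <= eps /\ e <= phi s / 2).
    { unfold e. split; [apply Rmin_glb_lt; lra|]. split; [apply Rmin_l|apply Rmin_r]. }
    (* Applied at phi s - e and phi s + e, where [U] is strictly below and above c; these signs
       persist for nearby t and trap phi t in between. *)
    assert (G : forall r, 0 < r -> forall eta, 0 < eta -> exists d, 0 < d /\
       forall t, Rabs (t - s) < d -> Rabs (U r t - U r s) < eta).
    { intros r Hr eta Heta.
      assert (Cr := derivable_pt_lim_continuity _ _ _
        (differentiable_pt_lim_slice_r _ _ _ _ _ (shear_U _ _ _ _ _ _ HS r s Hr))).
      destruct (Cr eta Heta) as [d [Hd Hcd]]. exists d. split; [exact Hd|].
      intros t Ht. destruct (Req_dec t s) as [->|Hne].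
      - rewrite Rminus_diag, Rabs_R0. exact Heta.
      - apply (Hcd t). split; [split; [exact I|congruence]|exact Ht]. }
    assert (HL := Hmono s (phi s - e) (phi s)). assert (HR := Hmono s (phi s) (phi s + e)).
    destruct (G (phi s - e) ltac:(lra) (c - U (phi s - e) s) ltac:(lra)) as [d1 [Hd1 G1]].
    destruct (G (phi s + e) ltac:(lra) (U (phi s + e) s - c) ltac:(lra)) as [d2 [Hd2 G2]].
    exists (Rmin d1 d2). split; [apply Rmin_glb_lt; assumption|].
    intros t [_ Ht]. simpl in Ht. unfold R_dist in Ht.
    specialize (G1 t (Rlt_le_trans _ _ _ Ht (Rmin_l _ _))).
    specialize (G2 t (Rlt_le_trans _ _ _ Ht (Rmin_r _ _))).
    apply Rabs_def2 in G1. apply Rabs_def2 in G2.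
    destruct (Hphi t) as [H3 H4].
    simpl. unfold R_dist. apply Rabs_def1.
    - destruct (Rlt_dec (phi t) (phi s + e)) as [Hlt|Hge]; [lra|].
      exfalso. destruct (Req_dec (phi t) (phi s + e)) as [E|Hne].
      + rewrite <- E in G2. lra.
      + specialize (Hmono t (phi s + e) (phi t)). lra.
    - destruct (Rlt_dec (phi s - e) (phi t)) as [Hlt|Hge]; [lra|].
      exfalso. destruct (Req_dec (phi t) (phi s - e)) as [E|Hne].
      + rewrite <- E in G1. lra.
      + specialize (Hmono t (phi t) (phi s - e)). lra. }
  (* By the chain rule with phi' = - Uy / Ux; this equals the Jacobian divided by Ux, hence is
     positive. *)
  set (dpsi := fun s => Vx (phi s) s * (- Uy (phi s) s / Ux (phi s) s) + Vy (phi s) s * 1).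
  assert (Hpsi : forall s, derivable_pt_lim (fun s => V (phi s) s) s (dpsi s)).
  { intros s. destruct (Hphi s) as [H1 H2].
    apply (derivable_pt_lim_comp_2d V phi (fun s => s)).
    - exact (shear_V _ _ _ _ _ _ HS _ s H1).
    - apply (implicit_derivative U).
      + exact (shear_U _ _ _ _ _ _ HS _ s H1).
      + exact (shear_Ux _ _ _ _ _ _ HS _ s H1).
      + apply Hcont.
      + intros v. rewrite H2. apply Hphi.
    - apply derivable_pt_lim_id. }
  exists phi. split; [|split].
  - intros r s. split.
    + intros [Hr HU]. now apply Huniq.
    + intros ->. apply Hphi.
  - intros s. exact (derivable_pt_lim_continuity _ _ _ (Hpsi s)).
  - intros s1 s2 Hs.
    apply (incr_function (fun s => V (phi s) s) m_infty p_infty dpsi); simpl; auto.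
    + intros s _ _. apply is_derive_Reals, Hpsi.
    + intros s _ _. destruct (Hphi s) as [H1 _].
      assert (P1 := shear_Ux _ _ _ _ _ _ HS _ s H1).
      assert (P2 := shear_jac _ _ _ _ _ _ HS _ s H1).
      unfold dpsi. apply Rlt_gt. apply Rmult_lt_reg_l with (Ux (phi s) s); [exact P1|].
      replace (Ux (phi s) s * (Vx (phi s) s * (- Uy (phi s) s / Ux (phi s) s) + Vy (phi s) s * 1))
        with (Ux (phi s) s * Vy (phi s) s - Uy (phi s) s * Vx (phi s) s) by (field; lra).
      lra.
Qed.

(** Both points lie on one level curve of [U], along which [V] is strictly increasing in s. *)
Lemma shear_injective (U V Ux Uy Vx Vy : R -> R -> R) (r1 s1 r2 s2 : R) :
  monotone_shear U V Ux Uy Vx Vy -> 0 < r1 -> 0 < r2 ->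
  U r1 s1 = U r2 s2 -> V r1 s1 = V r2 s2 -> r1 = r2 /\ s1 = s2.
Proof.
  intros HS H1 H2 HU HV.
  destruct (shear_level_curve _ _ _ _ _ _ _ r1 s1 HS H1 eq_refl) as [phi [Hphi [_ Hinc]]].
  assert (E1 : r1 = phi s1) by (apply Hphi; auto).
  assert (E2 : r2 = phi s2) by (apply Hphi; auto).
  assert (Es : s1 = s2).
  { rewrite E1, E2 in HV.
    destruct (Rtotal_order s1 s2) as [H|[H|H]]; [|exact H|]; apply Hinc in H; lra. }
  split; [congruence|exact Es].
Qed.

Lemma shear_connected (U V Ux Uy Vx Vy : R -> R -> R) (c : R) :
  monotone_shear U V Ux Uy Vx Vy ->
  C_connected (fun w => Re w = c /\ exists r s, 0 < r /\ w = (U r s, V r s)).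
Proof.
  intros HS P Q HP HQ Hcov HexP HexQ.
  (* The point in [P] shows that the level is nonempty, and then it is a full graph. *)
  assert (G := HexP). destruct G as [w [[Hw [r0 [s0 [Hr0 E]]]] _]].
  assert (Hc : U r0 s0 = c) by (rewrite E in Hw; exact Hw).
  destruct (shear_level_curve _ _ _ _ _ _ _ r0 s0 HS Hr0 Hc) as [phi [Hphi [Hcont _]]].
  assert (Heq : forall w, (Re w = c /\ exists r s, 0 < r /\ w = (U r s, V r s)) <->
     exists s, w = (c, V (phi s) s)).
  { intros w'. split.
    - intros [Hw' [r [s [Hr ->]]]]. simpl in Hw'. exists s.
      rewrite <- (proj1 (Hphi r s) (conj Hr Hw')). now rewrite Hw'.
    - intros [s ->]. split; [reflexivity|].
      destruct (proj2 (Hphi _ s) eq_refl) as [H1 H2].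
      exists (phi s), s. split; [exact H1|]. now rewrite H2. }
  destruct (connected_line_image _ c Hcont P Q HP HQ) as [w' [H1 H2]].
  - intros w' H'. apply Hcov. now apply Heq.
  - destruct HexP as [w' [H1 H2]]. exists w'. split; [now apply Heq|exact H2].
  - destruct HexQ as [w' [H1 H2]]. exists w'. split; [now apply Heq|exact H2].
  - exists w'. split; [now apply Heq|exact H2].
Qed.

(** * Shears on the disk *)

(** [is_derive_comp] takes the inner map with values in [AbsRing_NormedModule C_AbsRing]; the
    estimate passes by conversion and only linearity is proved again. *)
Lemma is_Cderive_comp (f g : C -> C) (z l m : C) :
  is_Cderive f (g z) l -> is_Cderive g z m -> is_Cderive (fun w => f (g w)) z (m * l)%C.
Proof.
  intros Hf [_ Hg]. refine (is_derive_comp (V := C_NormedModule) f g z l m Hf _).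
  split; [exact (is_linear_scal_l (V := AbsRing_NormedModule C_AbsRing) m)|exact Hg].
Qed.

Lemma is_Cderive_plus (f g : C -> C) (z l m : C) :
  is_Cderive f z l -> is_Cderive g z m -> is_Cderive (fun w => f w + g w)%C z (l + m)%C.
Proof. intros Hf Hg. exact (is_derive_plus (V := C_NormedModule) f g z l m Hf Hg). Qed.

Lemma is_Cderive_scal (f : C -> C) (c z l : C) :
  is_Cderive f z l -> is_Cderive (fun w => c * f w)%C z (c * l)%C.
Proof.
  rewrite !is_Cderive_eps. intros Hf eps He.
  assert (Hc := Cmod_ge_0 c).
  destruct (Hf (eps / (Cmod c + 1))) as [d [Hd Hw]]; [apply Rdiv_lt_0_compat; lra|].
  exists d. split; [exact Hd|]. intros w Hwd. specialize (Hw w Hwd).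
  replace (c * f w - c * f z - (w - z) * (c * l))%C
    with (c * (f w - f z - (w - z) * l))%C by ring.
  rewrite Cmod_mult.
  apply Rle_trans with (Cmod c * (eps / (Cmod c + 1) * Cmod (w - z)%C)).
  - now apply Rmult_le_compat_l.
  - assert (0 <= eps / (Cmod c + 1) * Cmod (w - z)%C).
    { apply Rmult_le_pos; [|apply Cmod_ge_0]. left. apply Rdiv_lt_0_compat; lra. }
    replace (eps * Cmod (w - z)%C) with ((Cmod c + 1) * (eps / (Cmod c + 1) * Cmod (w - z)%C))
      by (field; lra).
    lra.
Qed.

Lemma is_Cderive_Moebius (q : C) : (q + 1)%C <> 0 ->
  is_Cderive (fun q => (q - 1) / (q + 1))%C q (2 / ((q + 1) * (q + 1)))%C.
Proof.
  intros Hq. apply is_Cderive_eps. intros eps Heps.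
  set (m := Cmod (q + 1)%C). assert (Hm : 0 < m) by now apply Cmod_gt_0.
  assert (Hm3 : 0 < m * m * m) by (repeat apply Rmult_lt_0_compat; exact Hm).
  (* The first radius keeps |w + 1| above m / 2; the second comes from the exact remainder - 2 (w -
     q)^2 / ((w + 1) (q + 1)^2). *)
  exists (Rmin (m / 2) (eps * (m * m * m) / 4)). split.
  { apply Rmin_glb_lt; [lra|]. apply Rdiv_lt_0_compat; [nra|lra]. }
  intros w Hw.
  assert (Hw1 := Rlt_le_trans _ _ _ Hw (Rmin_l _ _)).
  assert (Hw2 := Rlt_le_trans _ _ _ Hw (Rmin_r _ _)).
  assert (Hmw : m / 2 < Cmod (w + 1)%C).
  { assert (H := Cmod_triangle (w + 1)%C (- (w - q))%C).
    replace (w + 1 + - (w - q))%C with (q + 1)%C in H by ring. fold m in H.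
    rewrite Cmod_opp in H. lra. }
  assert (Hw0 : (w + 1)%C <> 0) by (apply Cmod_gt_0; lra).
  set (d := Cmod (w - q)%C) in *. assert (Hd : 0 <= d) by apply Cmod_ge_0.
  replace ((w - 1) / (w + 1) - (q - 1) / (q + 1) - (w - q) * (2 / ((q + 1) * (q + 1))))%C
    with (- (2 * (w - q) * (w - q) / ((w + 1) * (q + 1) * (q + 1))))%C by (field; auto).
  rewrite Cmod_opp, Cmod_div by (repeat apply Cmult_neq_0; assumption).
  rewrite !Cmod_mult, Cmod_R, Rabs_pos_eq by lra. fold m. fold d.
  set (n := Cmod (w + 1)%C) in *.
  assert (Hn : 0 < n * m * m) by (repeat apply Rmult_lt_0_compat; lra).
  apply Rmult_le_reg_r with (n * m * m); [exact Hn|].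
  unfold Rdiv. rewrite Rmult_assoc, Rinv_l, Rmult_1_r by lra.
  assert (H1 : m * m * m / 2 <= n * m * m) by nra.
  assert (H2 : 2 * d <= eps * (n * m * m)) by nra.
  nra.
Qed.

Lemma Moebius_half_plane (q : C) : 0 < Re q ->
  (q + 1)%C <> 0 /\ 1 + Re q <= Cmod (q + 1)%C /\ unit_disk ((q - 1) / (q + 1))%C.
Proof.
  intros Hq.
  assert (H1 : 1 + Re q <= Cmod (q + 1)%C).
  { apply Rle_trans with (2 := re_le_Cmod _). apply Rle_trans with (2 := Rle_abs _).
    destruct q; simpl in *; lra. }
  assert (H0 : (q + 1)%C <> 0) by (apply Cmod_gt_0; lra).
  split; [exact H0|]. split; [exact H1|].
  unfold unit_disk. rewrite Cmod_div by exact H0.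
  apply Rmult_lt_reg_r with (Cmod (q + 1)%C); [lra|].
  unfold Rdiv. rewrite Rmult_assoc, Rinv_l, Rmult_1_r, Rmult_1_l by lra.
  destruct q as [a b]. unfold Cmod. apply sqrt_lt_1_alt. split.
  - apply Rplus_le_le_0_compat; apply pow2_ge_0.
  - simpl in *. lra.
Qed.

(** With a = H' and b = K' the halves are h' and g', so this expresses the Jacobian |h'|^2 - |g'|^2
    through the shear data. *)
Lemma Re_mult_conj_half_sum (a b : C) :
  Cmod ((a + b) / 2)%C ^ 2 - Cmod (Cconj ((a - b) / 2))%C ^ 2 = Re (b * Cconj a)%C.
Proof.
  rewrite Cmod_conj, !Cmod2_alt. destruct a as [a1 a2], b as [b1 b2]. simpl. field.
Qed.

(** The lines [s = const] are the rays from [0] in the right half-plane, hence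
    circular arcs from [-1] to [1] in the disk; [(1 - z^2) H'] is twice the
    derivative of [H] along them with respect to [ln r]. *)
Definition arc_point (r s : R) : C := let q := (r, r * s) in ((q - 1) / (q + 1))%C.

(** The complex derivative, with respect to q, of G composed with the map q -> (q - 1) / (q + 1), at
    q = r + i r s. *)
Definition arc_deriv (G' : C -> C) (r s : R) : C :=
  (2 / (((r, (r * s)%R) + 1) * ((r, (r * s)%R) + 1)) * G' (arc_point r s))%C.

Section Shear.

Context (H K H' K' : C -> C) (delta B : R).
Context (HH : forall z, unit_disk z -> is_Cderive H z (H' z)).
Context (HK : forall z, unit_disk z -> is_Cderive K z (K' z)).
Context (Hpos : forall z, unit_disk z -> 0 < Re ((1 - z * z) * H' z)%C).
Context (Hjac : forall z, unit_disk z -> 0 < Re (K' z * Cconj (H' z))%C).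
Context (Hdelta : 0 < delta).
Context (Hbound : forall z, unit_disk z ->
  Cmod (z - 1)%C < delta \/ Cmod (z + 1)%C < delta -> Cmod (H' z) <= B).

Lemma disk_chart (r s : R) : 0 < r -> unit_disk (arc_point r s).
Proof. intros Hr. now apply (Moebius_half_plane (r, r * s)). Qed.

(** For q = r + i r s the partial derivatives are dq/dr = 1 + i s and dq/ds = i r; multiply each by
    [arc_deriv] and take real and imaginary parts. *)
Lemma differentiable_in_chart (G G' : C -> C) (r s : R) :
  (forall z, unit_disk z -> is_Cderive G z (G' z)) -> 0 < r ->
  differentiable_pt_lim (fun r s => Re (G (arc_point r s))) r s
    (Re (arc_deriv G' r s) - s * Im (arc_deriv G' r s)) (- r * Im (arc_deriv G' r s)) /\
  differentiable_pt_lim (fun r s => Im (G (arc_point r s))) r s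
    (Im (arc_deriv G' r s) + s * Re (arc_deriv G' r s)) (r * Re (arc_deriv G' r s)).
Proof.
  intros HG Hr.
  destruct (Moebius_half_plane (r, r * s) Hr) as [Hne [_ Hdisk]].
  assert (Hc := is_Cderive_comp G (fun q => (q - 1) / (q + 1))%C _ _ _ (HG _ Hdisk) (is_Cderive_Moebius _ Hne)).
  apply is_Cderive_differentiable in Hc. destruct Hc as [H1 H2].
  assert (Hrs := differentiable_pt_lim_mult _ _ _ _ _ _ _ _
    (differentiable_pt_lim_fst r s) (differentiable_pt_lim_snd r s)).
  split.
  - eapply differentiable_pt_lim_eq; [| | |exact (differentiable_pt_lim_comp _ _ _ _ _ _ _ _ _ _ _
      H1 (differentiable_pt_lim_fst r s) Hrs)].
    + reflexivity.
    + unfold arc_deriv, arc_point. ring.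
    + unfold arc_deriv, arc_point. ring.
  - eapply differentiable_pt_lim_eq; [| | |exact (differentiable_pt_lim_comp _ _ _ _ _ _ _ _ _ _ _
      H2 (differentiable_pt_lim_fst r s) Hrs)].
    + reflexivity.
    + unfold arc_deriv, arc_point. ring.
    + unfold arc_deriv, arc_point. ring.
Qed.

(** Since 1 - z^2 = 4 q / (q + 1)^2, the quantity in [Hpos] is 2 r times the real part of (1 + i s)
    [arc_deriv]. *)
Lemma chart_radial_derivative_pos (r s : R) : 0 < r ->
  0 < Re (arc_deriv H' r s) - s * Im (arc_deriv H' r s).
Proof.
  intros Hr.
  destruct (Moebius_half_plane (r, r * s) Hr) as [Hne [_ Hdisk]].
  assert (Hp := Hpos _ Hdisk).
  replace ((1 - ((r, (r * s)%R) - 1) / ((r, (r * s)%R) + 1) * (((r, (r * s)%R) - 1) / ((r, (r * s)%R) + 1))) *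
    H' (((r, (r * s)%R) - 1) / ((r, (r * s)%R) + 1)))%C
    with (2 * (r, (r * s)%R) * arc_deriv H' r s)%C in Hp by (unfold arc_deriv, arc_point; field; exact Hne).
  set (d := arc_deriv H' r s) in *. destruct d as [d1 d2]. simpl in Hp |- *. nra.
Qed.

(** The determinant factors as r |k|^2 Re (K' conj H'): r belongs to (r, s) -> (r, r s), and k is
    the derivative of the Moebius map. *)
Lemma chart_jacobian_pos (r s : R) : 0 < r ->
  0 < (Re (arc_deriv H' r s) - s * Im (arc_deriv H' r s)) * (r * Re (arc_deriv K' r s))
      - (- r * Im (arc_deriv H' r s)) * (Im (arc_deriv K' r s) + s * Re (arc_deriv K' r s)).
Proof.
  intros Hr.
  destruct (Moebius_half_plane (r, r * s) Hr) as [Hne [_ Hdisk]].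
  assert (Hp := Hjac _ (disk_chart r s Hr)).
  set (k := (2 / (((r, (r * s)%R) + 1) * ((r, (r * s)%R) + 1)))%C).
  assert (Hk : 0 < Cmod k ^ 2).
  { apply pow_lt, Cmod_gt_0. unfold k. intros E.
    apply (f_equal (fun c => c * (((r, (r * s)%R) + 1) * ((r, (r * s)%R) + 1)))%C) in E.
    field_simplify in E; [|exact Hne].
    assert (E2 := f_equal fst E). simpl in E2. lra. }
  rewrite Cmod2_alt in Hk.
  unfold arc_deriv. fold k.
  destruct k as [k1 k2], (H' (arc_point r s)) as [a b], (K' (arc_point r s)) as [c d]. simpl in Hp, Hk |- *.
  match goal with |- 0 < ?x =>
    replace x with (r * ((k1 * (k1 * 1) + k2 * (k2 * 1)) * (c * a - d * - b))) by ring end.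
  apply Rmult_lt_0_compat; [exact Hr|]. apply Rmult_lt_0_compat; assumption.
Qed.

(** From |q + 1| >= 1 + r. The resulting decay of the s-derivative at r = 0 and at infinity gives
    the common end behaviour of all rays. *)
Lemma chart_transverse_bound (r s : R) : 0 < r ->
  Cmod (arc_point r s - 1)%C < delta \/ Cmod (arc_point r s + 1)%C < delta ->
  Rabs (- r * Im (arc_deriv H' r s)) * (1 + r) ^ 2 <= 2 * B * r.
Proof.
  intros Hr Hd.
  destruct (Moebius_half_plane (r, r * s) Hr) as [Hne [Hm _]].
  assert (Hb := Hbound _ (disk_chart r s Hr) Hd).
  assert (HI := Im_le_Cmod (arc_deriv H' r s)).
  rewrite Rabs_mult, Rabs_Ropp, (Rabs_pos_eq r) by lra.
  unfold arc_deriv at 2 in HI. rewrite Cmod_mult, Cmod_div in HI by now apply Cmult_neq_0.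
  rewrite Cmod_mult, Cmod_R, (Rabs_pos_eq 2) in HI by lra.
  change (1 + r <= Cmod ((r, (r * s)%R) + 1)%C) in Hm. set (m := Cmod ((r, (r * s)%R) + 1)%C) in *.
  set (i := Rabs _) in *. set (h := Cmod (H' _)) in *.
  assert (Hh : 0 <= h) by apply Cmod_ge_0.
  assert (Hi : 0 <= i) by apply Rabs_pos.
  assert (H1 : i * (m * m) <= 2 * h).
  { apply Rmult_le_compat_r with (r := m * m) in HI; [|nra].
    replace (2 / (m * m) * h * (m * m)) with (2 * h) in HI by (field; lra). exact HI. }
  assert (H2 : i * (1 + r) ^ 2 <= i * (m * m)).
  { apply Rmult_le_compat_l; [exact Hi|]. nra. }
  nra.
Qed.

Lemma arc_point_near_1 (r s : R) : 0 < r -> Cmod (arc_point r s - 1)%C <= 2 / r.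
Proof.
  intros Hr. destruct (Moebius_half_plane (r, r * s) Hr) as [Hne [Hm _]].
  unfold arc_point. set (q := (r, r * s)) in *.
  replace ((q - 1) / (q + 1) - 1)%C with (- (2 / (q + 1)))%C by (field; exact Hne).
  rewrite Cmod_opp, Cmod_div, Cmod_R, Rabs_pos_eq by (lra || exact Hne).
  simpl in Hm. unfold Rdiv. apply Rmult_le_compat_l; [lra|]. apply Rinv_le_contravar; lra.
Qed.

(** Unlike at 1, the estimate depends on s, because |q| does; s must therefore be kept in a bounded
    range. *)
Lemma arc_point_near_m1 (r s : R) : 0 < r -> Cmod (arc_point r s + 1)%C <= 2 * (r * (1 + Rabs s)).
Proof.
  intros Hr. destruct (Moebius_half_plane (r, r * s) Hr) as [Hne [Hm _]].
  unfold arc_point. set (q := (r, r * s)) in *.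
  replace ((q - 1) / (q + 1) + 1)%C with (2 * q / (q + 1))%C by (field; exact Hne).
  rewrite Cmod_div, Cmod_mult, Cmod_R, Rabs_pos_eq by (lra || exact Hne).
  assert (Hq := Cmod_le_Re_Im q). simpl in Hm, Hq.
  rewrite Rabs_mult, (Rabs_pos_eq r) in Hq by lra.
  assert (Hq0 := Cmod_ge_0 q).
  apply Rmult_le_reg_r with (Cmod (q + 1)%C); [lra|].
  unfold Rdiv. rewrite Rmult_assoc, Rinv_l, Rmult_1_r by lra. nra.
Qed.

(** The mean value theorem in s at fixed r, whose intermediate point is no larger in absolute value
    than the larger endpoint. *)
Lemma chart_variation (r s1 s2 c : R) : 0 < r -> 
  (forall s, Rabs s <= Rmax (Rabs s1) (Rabs s2) -> Rabs (- r * Im (arc_deriv H' r s)) <= c) ->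
  Rabs (Re (H (arc_point r s1)) - Re (H (arc_point r s2))) <= c * Rabs (s1 - s2).
Proof.
  intros Hr Hc.
  assert (Hder : forall s, derivable_pt_lim (fun s => Re (H (arc_point r s))) s (- r * Im (arc_deriv H' r s))).
  { intros s. exact (differentiable_pt_lim_slice_r _ _ _ _ _ (proj1 (differentiable_in_chart H H' r s HH Hr))). }
  destruct (MVT_gen (fun s => Re (H (arc_point r s))) s2 s1 (fun s => - r * Im (arc_deriv H' r s))) as [s [Hs E]].
  - intros s _. apply is_derive_Reals, Hder.
  - intros s _. exact (derivable_pt_lim_continuity _ _ _ (Hder s)).
  - rewrite E, Rabs_mult. apply Rmult_le_compat_r; [apply Rabs_pos|]. apply Hc.
    revert Hs. unfold Rmin, Rmax, Rabs.
    repeat (destruct (Rle_dec _ _) || destruct (Rcase_abs _)); lra.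
Qed.

Lemma holomorphic_monotone_shear :
  monotone_shear (fun r s => Re (H (arc_point r s))) (fun r s => Im (K (arc_point r s)))
    (fun r s => Re (arc_deriv H' r s) - s * Im (arc_deriv H' r s)) (fun r s => - r * Im (arc_deriv H' r s))
    (fun r s => Im (arc_deriv K' r s) + s * Re (arc_deriv K' r s)) (fun r s => r * Re (arc_deriv K' r s)).
Proof.
  assert (HB : 0 <= B).
  (* A real sample point close to 1: [B] bounds a modulus there, hence is nonnegative. *)
  { set (z := RtoC (1 - Rmin 1 delta / 2)).
    assert (Hm := Rmin_l 1 delta). assert (Hm' := Rmin_r 1 delta).
    assert (Hm0 : 0 < Rmin 1 delta) by (apply Rmin_glb_lt; lra).
    apply Rle_trans with (Cmod (H' z)); [apply Cmod_ge_0|]. apply Hbound.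
    - unfold unit_disk, z. rewrite Cmod_R. apply Rabs_def1; lra.
    - left. unfold z. rewrite <- RtoC_minus, Cmod_R. apply Rabs_def1; lra. }
  split.
  - intros r s Hr. apply (differentiable_in_chart H H' r s HH Hr).
  - intros r s Hr. apply (differentiable_in_chart K K' r s HK Hr).
  - apply chart_radial_derivative_pos.
  - apply chart_jacobian_pos.
  - intros s1 s2 eps Heps. assert (Hd := Rabs_pos (s1 - s2)).
    assert (P1 : 0 <= 2 / delta) by (apply Rdiv_le_0_compat; lra).
    assert (P2 : 0 <= 2 * B * Rabs (s1 - s2) / eps) by (apply Rdiv_le_0_compat; nra).
    (* The term 2 / delta brings the points within [delta] of 1, the last term makes 2 B |s1 - s2| /
       r less than [eps], and the 1 makes both strict. *)
    exists (1 + 2 / delta + 2 * B * Rabs (s1 - s2) / eps). split; [lra|].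
    intros r Hr. assert (Hr0 : 0 < r) by lra.
    assert (Q1 : 2 < r * delta).
    { apply Rlt_le_trans with ((1 + 2 / delta) * delta).
      - replace ((1 + 2 / delta) * delta) with (delta + 2) by (field; lra). lra.
      - apply Rmult_le_compat_r; lra. }
    assert (Q2 : 2 * B * Rabs (s1 - s2) < r * eps).
    { apply Rlt_le_trans with ((1 + 2 * B * Rabs (s1 - s2) / eps) * eps).
      - replace ((1 + 2 * B * Rabs (s1 - s2) / eps) * eps) with (eps + 2 * B * Rabs (s1 - s2)) by (field; lra). lra.
      - apply Rmult_le_compat_r; lra. }
    apply Rle_lt_trans with (2 * B / r * Rabs (s1 - s2)).
    + apply chart_variation; [exact Hr0|]. intros s _.
      assert (N : Cmod (arc_point r s - 1)%C < delta).
      { apply Rle_lt_trans with (1 := arc_point_near_1 r s Hr0).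
        apply Rmult_lt_reg_r with r; [lra|]. replace (2 / r * r) with 2 by (field; lra). lra. }
      assert (T := chart_transverse_bound r s Hr0 (or_introl N)).
      set (u := Rabs (- r * Im (arc_deriv H' r s))) in *. assert (Hu : 0 <= u) by apply Rabs_pos.
      apply Rmult_le_reg_r with (r * r); [nra|].
      replace (2 * B / r * (r * r)) with (2 * B * r) by (field; lra). nra.
    + apply Rmult_lt_reg_r with r; [lra|].
      replace (2 * B / r * Rabs (s1 - s2) * r) with (2 * B * Rabs (s1 - s2)) by (field; lra). lra.
  - intros s1 s2 eps Heps. assert (Hd := Rabs_pos (s1 - s2)).
    set (S := Rmax (Rabs s1) (Rabs s2)).
    assert (HS : 0 <= S) by (apply Rle_trans with (2 := Rmax_l _ _); apply Rabs_pos).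
    (* [m1] brings the points within [delta] of -1; [m2] makes 2 B r |s1 - s2| less than [eps], with
       + 1 guarding against a zero denominator. *)
    set (m1 := delta / (4 * (1 + S))). set (m2 := eps / (2 * B * Rabs (s1 - s2) + 1) / 2).
    assert (Hm1 : 0 < m1) by (apply Rdiv_lt_0_compat; lra).
    assert (HBd : 0 <= 2 * B * Rabs (s1 - s2)) by nra.
    assert (Hm2 : 0 < m2) by (apply Rdiv_lt_0_compat; [apply Rdiv_lt_0_compat; lra|lra]).
    exists (Rmin m1 m2). split; [now apply Rmin_glb_lt|].
    intros r [Hr0 Hr].
    assert (R1 := Rle_trans _ _ _ Hr (Rmin_l _ _)). assert (R2 := Rle_trans _ _ _ Hr (Rmin_r _ _)).
    assert (Q1 : 2 * (r * (1 + S)) < delta).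
    { apply Rle_lt_trans with (2 * (m1 * (1 + S))); [nra|].
      replace (2 * (m1 * (1 + S))) with (delta / 2) by (unfold m1; field; lra). lra. }
    assert (Q2 : 2 * B * r * Rabs (s1 - s2) < eps).
    { apply Rle_lt_trans with (m2 * (2 * B * Rabs (s1 - s2) + 1)); [nra|].
      replace (m2 * (2 * B * Rabs (s1 - s2) + 1)) with (eps / 2) by (unfold m2; field; lra). lra. }
    apply Rle_lt_trans with (2 * B * r * Rabs (s1 - s2)); [|exact Q2].
    apply chart_variation; [exact Hr0|]. intros s Hs. fold S in Hs.
    assert (N : Cmod (arc_point r s + 1)%C < delta).
    { apply Rle_lt_trans with (1 := arc_point_near_m1 r s Hr0). apply Rle_lt_trans with (2 := Q1).
      assert (r * (1 + Rabs s) <= r * (1 + S)) by (apply Rmult_le_compat_l; lra). lra. }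
    assert (T := chart_transverse_bound r s Hr0 (or_intror N)).
    set (u := Rabs (- r * Im (arc_deriv H' r s))) in *. assert (Hu : 0 <= u) by apply Rabs_pos.
    nra.
Qed.

(** Inverting the Moebius map gives q = (1 + z) / (1 - z), with real part (1 - |z|^2) / |1 -
    z|^2. *)
Lemma chart_surjective (z : C) : unit_disk z -> exists r s, 0 < r /\ z = arc_point r s.
Proof.
  intros Hz.
  assert (Hne : (1 - z)%C <> 0).
  { replace (1 - z)%C with (1 + - z)%C by ring. apply unit_disk_one_plus_neq_0.
    unfold unit_disk. now rewrite Cmod_opp. }
  set (q := ((1 + z) / (1 - z))%C).
  assert (Hq : 0 < Re q).
  { assert (Hz2 : Cmod z ^ 2 < 1).
    { unfold unit_disk in Hz. assert (H0 := Cmod_ge_0 z). nra. }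
    rewrite Cmod2_alt in Hz2. destruct z as [x y]. simpl in Hz2.
    assert (Hx := unit_disk_Re _ Hz). simpl in Hx.
    replace (Re q) with ((1 - x * x - y * y) / ((1 - x) * (1 - x) + y * y)).
    - apply Rdiv_lt_0_compat; nra.
    - unfold q. simpl. field. repeat split; nra. }
  exists (Re q), (Im q / Re q). split; [exact Hq|].
  unfold arc_point. replace (Re q, Re q * (Im q / Re q)) with q.
  - unfold q. field. split; [exact Hne|].
    replace (1 + z + (1 - z))%C with (RtoC 2) by (replace 2 with (1 + 1) by ring; rewrite RtoC_plus; ring).
    intros E. apply RtoC_inj in E. lra.
  - rewrite (surjective_pairing q) at 1. unfold Re, Im in *. f_equal. field. lra.
Qed.

Lemma shear_univalent : univalent (fun z => (Re (H z), Im (K z))).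
Proof.
  intros u v Hu Hv E.
  destruct (chart_surjective u Hu) as [r1 [s1 [Hr1 ->]]].
  destruct (chart_surjective v Hv) as [r2 [s2 [Hr2 ->]]].
  injection E as E1 E2.
  destruct (shear_injective _ _ _ _ _ _ _ _ _ _ holomorphic_monotone_shear Hr1 Hr2 E1 E2) as [-> ->].
  reflexivity.
Qed.

Lemma shear_convex_imaginary_direction :
  convex_imaginary_direction (fun z => (Re (H z), Im (K z))).
Proof.
  intros c P Q HP HQ Hcov [w1 [[C1 [z1 [D1 E1]]] P1]] [w2 [[C2 [z2 [D2 E2]]] Q2]].
  destruct (shear_connected _ _ _ _ _ _ c holomorphic_monotone_shear P Q HP HQ) as [w [[A1 [r [s [Hr Hw]]]] A2]].
  - intros w [Hc [r [s [Hr ->]]]]. apply Hcov. split; [exact Hc|].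
    exists (arc_point r s). split; [now apply disk_chart|reflexivity].
  - exists w1. split; [split; [exact C1|]|exact P1].
    destruct (chart_surjective z1 D1) as [r [s [Hr ->]]]. exists r, s. auto.
  - exists w2. split; [split; [exact C2|]|exact Q2].
    destruct (chart_surjective z2 D2) as [r [s [Hr ->]]]. exists r, s. auto.
  - exists w. split; [split; [exact A1|]|exact A2].
    exists (arc_point r s). split; [now apply disk_chart|now symmetry].
Qed.

End Shear.

(** * Estimates for the derivative of [F] *)

Lemma telescoping_product (n a : nat) (z : C) :
  ((1 - z ^ (2 ^ a)) * fold_right Cmult 1 (map (fun k => 1 + z ^ (2 ^ k)) (seq a n)))%C
  = (1 - z ^ (2 ^ (a + n)))%C.
Proof.
  revert a. induction n as [|n IH]; intros a; simpl.
  - rewrite Nat.add_0_r. ring.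
  - replace (a + S n)%nat with (S a + n)%nat by lia. rewrite <- IH.
    replace (2 ^ S a)%nat with (2 ^ a + 2 ^ a)%nat by (simpl; lia).
    rewrite Cpow_add_r. ring.
Qed.

Lemma prod_factor_telescoping (N : nat) (z : C) : (1 <= N)%nat ->
  ((1 - z * z) * prod_factor N z)%C = (1 - z ^ (2 ^ N))%C.
Proof.
  intros HN. assert (H := telescoping_product (N - 1) 1 z).
  replace (1 + (N - 1))%nat with N in H by lia. rewrite <- H. unfold prod_factor.
  simpl Nat.pow. simpl Cpow. ring.
Qed.

Lemma Re_div_pos (a b : C) : b <> 0 -> 0 < Re (a * Cconj b)%C -> 0 < Re (a / b)%C.
Proof.
  intros Hb H.
  assert (Hm : 0 < Cmod b ^ 2) by now apply pow_lt, Cmod_gt_0.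
  rewrite Cmod2_alt in Hm. destruct a as [a1 a2], b as [b1 b2]. simpl in *.
  replace (a1 * (b1 / (b1 * (b1 * 1) + b2 * (b2 * 1))) - a2 * (- b2 / (b1 * (b1 * 1) + b2 * (b2 * 1))))
    with ((a1 * b1 - a2 * - b2) / (b1 * (b1 * 1) + b2 * (b2 * 1))) by (field; lra).
  now apply Rdiv_lt_0_compat.
Qed.

(** With r = |w|, the numerator times the conjugate denominator has real part 1 - r^8 + alpha (1 -
    r^2) Re v, and |v| <= r (1 + r^2)^2. For |alpha| <= 1 this is at least (1 - r^2) (1 + r^2) (1 -
    r) (1 - r^3). *)
Lemma Re_kernel_pos (alpha : R) (w : C) : Rabs alpha <= 1 -> unit_disk w ->
  0 < Re ((1 - w ^ 4 + alpha * (w - w ^ 3)) / (1 + w ^ 4))%C.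
Proof.
  intros Ha Hw.
  apply Re_div_pos; [apply unit_disk_one_plus_neq_0, Cpow_disk; [exact Hw|lia]|].
  unfold unit_disk in Hw. assert (Hr := Cmod_ge_0 w). set (r := Cmod w) in *.
  assert (Hr2 : Re w ^ 2 + Im w ^ 2 = r ^ 2) by (unfold r; now rewrite Cmod2_alt).
  set (v := ((1 + r ^ 2 + r ^ 4)%R * w - w ^ 3)%C).
  assert (E : Re ((1 - w ^ 4 + alpha * (w - w ^ 3)) * Cconj (1 + w ^ 4))%C
    = 1 - r ^ 8 + alpha * ((1 - r ^ 2) * Re v)).
  { replace (r ^ 8) with ((r ^ 2) ^ 4) by ring.
    unfold v. replace (r ^ 4) with ((r ^ 2) ^ 2) by ring. rewrite <- Hr2.
    destruct w as [x y]. simpl. ring. }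
  rewrite E.
  assert (Hv : Rabs (Re v) <= r * (1 + r ^ 2) ^ 2).
  { apply Rle_trans with (1 := re_le_Cmod v). unfold v.
    apply Rle_trans with (1 := Cmod_triangle _ _).
    rewrite Cmod_opp, Cmod_mult, Cmod_pow, Cmod_R. fold r.
    rewrite Rabs_pos_eq by (assert (H := pow_le r 2 Hr); assert (H' := pow_le r 4 Hr); lra).
    apply Req_le. ring. }
  assert (H2 : 0 < 1 - r ^ 2) by nra.
  assert (Hav : - (r * (1 + r ^ 2) ^ 2) <= alpha * Re v).
  { assert (H : Rabs (alpha * Re v) <= r * (1 + r ^ 2) ^ 2).
    { rewrite Rabs_mult. assert (H := Rabs_pos (Re v)). nra. }
    apply Rabs_le_between in H. lra. }
  replace (1 - r ^ 8 + alpha * ((1 - r ^ 2) * Re v))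
    with ((1 - r ^ 2) * ((1 + r ^ 2) * (1 + r ^ 4) + alpha * Re v)) by ring.
  apply Rmult_lt_0_compat; [exact H2|].
  assert (H3 : 0 < (1 - r) * (1 - r ^ 3)).
  { apply Rmult_lt_0_compat; [lra|]. assert (r ^ 3 < 1); [|lra].
    apply pow_lt_1_compat; [lra|lia]. }
  assert (H4 : 0 < (1 + r ^ 2) * ((1 - r) * (1 - r ^ 3))) by (apply Rmult_lt_0_compat; nra).
  apply Rlt_le_trans with (2 := Rplus_le_compat_l _ _ _ Hav).
  replace ((1 + r ^ 2) * (1 + r ^ 4) + - (r * (1 + r ^ 2) ^ 2))
    with ((1 + r ^ 2) * ((1 - r) * (1 - r ^ 3))) by ring.
  exact H4.
Qed.

Lemma Re_F_deriv_pos (alpha : R) (N : nat) (z : C) :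
  Rabs alpha <= 1 -> (1 <= N)%nat -> unit_disk z ->
  0 < Re ((1 - z * z) * F_deriv alpha N z)%C.
Proof.
  intros Ha HN Hz. set (w := (z ^ (2 ^ (N - 1)))%C).
  assert (Hw : unit_disk w).
  { apply Cpow_disk; [exact Hz|]. apply Nat.neq_0_lt_0, Nat.pow_nonzero; lia. }
  assert (E2 : (z ^ (2 ^ N))%C = (w ^ 2)%C).
  { unfold w. rewrite <- Cpow_mult_r. f_equal. destruct N as [|N]; [lia|].
    simpl. rewrite Nat.sub_0_r. lia. }
  assert (E4 : (z ^ (2 ^ (N + 1)))%C = (w ^ 4)%C).
  { replace (w ^ 4)%C with ((w ^ 2) * (w ^ 2))%C by ring. rewrite <- E2, <- Cpow_add_r.
    f_equal. rewrite Nat.add_1_r. simpl. lia. }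
  assert (H := Re_kernel_pos alpha w Ha Hw).
  replace ((1 - z * z) * F_deriv alpha N z)%C
    with ((1 - w ^ 4 + alpha * (w - w ^ 3)) / (1 + w ^ 4))%C; [exact H|].
  unfold F_deriv. rewrite E4. unfold Cdiv. rewrite !Cmult_assoc.
  rewrite prod_factor_telescoping, E2 by exact HN. fold w. ring.
Qed.

(** * Boundedness near the end points of the arcs *)

Lemma Cmod_pow_minus_le (z u : C) (n : nat) : Cmod z <= 1 -> Cmod u <= 1 ->
  Cmod (z ^ n - u ^ n)%C <= INR n * Cmod (z - u)%C.
Proof.
  intros Hz Hu. induction n as [|n IH].
  - simpl. replace (1 - 1)%C with (RtoC 0) by ring. rewrite Cmod_0. lra.
  - replace (z ^ S n - u ^ S n)%C with (z * (z ^ n - u ^ n) + (z - u) * u ^ n)%C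
      by (rewrite !Cpow_S; ring).
    apply Rle_trans with (1 := Cmod_triangle _ _).
    rewrite !Cmod_mult, Cmod_pow, S_INR.
    assert (Hp : Cmod u ^ n <= 1).
    { rewrite <- (pow1 n). apply pow_incr. split; [apply Cmod_ge_0|exact Hu]. }
    assert (H1 := Cmod_ge_0 (z ^ n - u ^ n)%C). assert (H2 := Cmod_ge_0 (z - u)%C).
    assert (H3 := Cmod_ge_0 z). nra.
Qed.

Lemma Cmod_one_plus_pow_le (z : C) (k : nat) : unit_disk z -> Cmod (1 + z ^ k)%C <= 2.
Proof.
  intros Hz. apply Rle_trans with (1 := Cmod_triangle _ _).
  rewrite Cmod_1, Cmod_pow. unfold unit_disk in Hz.
  assert (Cmod z ^ k <= 1); [|lra].
  rewrite <- (pow1 k). apply pow_incr. split; [apply Cmod_ge_0|lra].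
Qed.

(** As M is even, both 1 and -1 satisfy u^M = 1. Since u -> u^M is M-Lipschitz on the closed disk,
    within 1 / M of them z^M is within 1 of 1, and the denominator has modulus at least 1. *)
Lemma F_deriv_bounded_near_pm1 (alpha : R) (N : nat) :
  exists delta B, 0 < delta /\ forall z, unit_disk z ->
    Cmod (z - 1)%C < delta \/ Cmod (z + 1)%C < delta -> Cmod (F_deriv alpha N z) <= B.
Proof.
  set (M := (2 ^ (N + 1))%nat).
  assert (HM : 0 < INR M).
  { apply lt_0_INR. unfold M. apply Nat.neq_0_lt_0, Nat.pow_nonzero; lia. }
  (* The length is left unevaluated so that the bound follows the induction on the list of
     exponents. *)
  exists (/ INR M), (2 ^ length (seq 1 (N - 1)) * (2 + Rabs alpha)).
  split; [now apply Rinv_0_lt_compat|].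
  intros z Hz Hd.
  assert (Hpow : Cmod (z ^ M - 1)%C < 1).
  { assert (G : forall u : C, Cmod u <= 1 -> (u ^ M = 1)%C -> Cmod (z - u)%C < / INR M ->
      Cmod (z ^ M - 1)%C < 1).
    { intros u Hu Hu1 Hzu. rewrite <- Hu1.
      apply Rle_lt_trans with (1 := Cmod_pow_minus_le z u M (Rlt_le _ _ Hz) Hu).
      apply Rmult_lt_compat_l with (r := INR M) in Hzu; [|exact HM].
      rewrite Rinv_r in Hzu; lra. }
    destruct Hd as [Hd|Hd].
    - apply (G 1); [rewrite Cmod_1; lra|apply Cpow_1_l|exact Hd].
    - apply (G (- (1))%C); [rewrite Cmod_m1; lra| |].
      + unfold M. rewrite Nat.add_1_r. change (2 ^ S N)%nat with (2 * 2 ^ N)%nat.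
        rewrite Cpow_mult_r. replace ((- (1)) ^ 2)%C with (RtoC 1) by (simpl; ring).
        apply Cpow_1_l.
      + replace (z - - (1))%C with (z + 1)%C by ring. exact Hd. }
  assert (Hden : 1 <= Cmod (1 + z ^ M)%C).
  { assert (H := Cmod_triangle (1 + z ^ M)%C (- (z ^ M - 1))%C).
    replace (1 + z ^ M + - (z ^ M - 1))%C with (1 + 1)%C in H by ring.
    rewrite <- RtoC_plus, Cmod_R, Rabs_pos_eq, Cmod_opp in H by lra. lra. }
  assert (Hprod : Cmod (prod_factor N z) <= 2 ^ length (seq 1 (N - 1))).
  { unfold prod_factor. induction (seq 1 (N - 1)) as [|k l IH]; simpl.
    - rewrite Cmod_1. lra.
    - rewrite Cmod_mult. apply Rmult_le_compat; try apply Cmod_ge_0; [|exact IH].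
      now apply Cmod_one_plus_pow_le. }
  assert (Hnum : Cmod (1 + z ^ (2 ^ N) + RtoC alpha * z ^ (2 ^ (N - 1)))%C <= 2 + Rabs alpha).
  { apply Rle_trans with (1 := Cmod_triangle _ _). apply Rplus_le_compat.
    - now apply Cmod_one_plus_pow_le.
    - rewrite Cmod_mult, Cmod_R, Cmod_pow. rewrite <- (Rmult_1_r (Rabs alpha)) at 2.
      apply Rmult_le_compat_l; [apply Rabs_pos|].
      rewrite <- (pow1 (2 ^ (N - 1))). apply pow_incr. split; [apply Cmod_ge_0|now left]. }
  unfold F_deriv. fold M.
  rewrite Cmod_div, Cmod_mult by (apply Cmod_gt_0; lra).
  set (p := Cmod (prod_factor N z)) in *. set (q := Cmod (_ + _ * _)%C) in *.
  assert (Hp : 0 <= p) by apply Cmod_ge_0. assert (Hq : 0 <= q) by apply Cmod_ge_0.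
  apply Rle_trans with (p * q).
  - apply Rmult_le_reg_r with (Cmod (1 + z ^ M)%C); [lra|].
    unfold Rdiv. rewrite Rmult_assoc, Rinv_l, Rmult_1_r by lra.
    assert (0 <= p * q) by now apply Rmult_le_pos. nra.
  - now apply Rmult_le_compat.
Qed.

(** * Wirtinger derivatives and the conclusion *)

Lemma wirtinger_of_shear (f H K : C -> C) (z a b : C) :
  (forall w, f w = (Re (H w), Im (K w))) -> is_Cderive H z a -> is_Cderive K z b ->
  d_z f z = ((a + b) / 2)%C /\ d_zbar f z = Cconj ((a - b) / 2)%C.
Proof.
  intros Hf HH HK. destruct z as [x y].
  apply is_Cderive_differentiable in HH. apply is_Cderive_differentiable in HK.
  destruct (differentiable_pt_lim_unique _ _ _ _ _ (proj1 HH)) as [H1 H2].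
  destruct (differentiable_pt_lim_unique _ _ _ _ _ (proj2 HK)) as [K1 K2].
  (* The Cauchy-Riemann equations give f_x = Re a + i Im b and f_y = - Im a + i Re b. *)
  assert (Ex : partial_x f (x, y) = (Re a, Im b)).
  { unfold partial_x. simpl. f_equal.
    - rewrite <- H1. apply Derive_ext. intros t. now rewrite Hf.
    - rewrite <- K1. apply Derive_ext. intros t. now rewrite Hf. }
  assert (Ey : partial_y f (x, y) = (- Im a, Re b)).
  { unfold partial_y. simpl. f_equal.
    - rewrite <- H2. apply Derive_ext. intros t. now rewrite Hf.
    - rewrite <- K2. apply Derive_ext. intros t. now rewrite Hf. }
  unfold d_z, d_zbar. rewrite Ex, Ey. destruct a as [a1 a2], b as [b1 b2].
  split; apply injective_projections; simpl; field.
Qed.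

(** Places the allowed range of alpha inside [-1, 1], where the kernel estimate applies. *)
Lemma double_sqrt2_minus_1_le_1 : 2 * (sqrt 2 - 1) <= 1.
Proof.
  assert (sqrt 2 <= 3 / 2); [|lra].
  rewrite <- (sqrt_pow2 (3 / 2)) by lra. apply sqrt_le_1; lra.
Qed.

Lemma is_Cderive_comb (f g : C -> C) (c d z l m : C) :
  is_Cderive f z l -> is_Cderive g z m ->
  is_Cderive (fun w => c * f w + d * g w)%C z (c * l + d * m)%C.
Proof.
  intros Hf Hg.
  exact (is_Cderive_plus _ _ _ _ _ (is_Cderive_scal f c z l Hf) (is_Cderive_scal g d z m Hg)).
Qed.

Theorem theorem3p6 :
  forall (n m : nat) (alpha1 alpha2 t : R) (h1 g1 h2 g2 : C -> C),
    (1 <= n)%nat -> (1 <= m)%nat ->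
    - (2 * (sqrt 2 - 1)) <= alpha1 <= 2 * (sqrt 2 - 1) ->
    - (2 * (sqrt 2 - 1)) <= alpha2 <= 2 * (sqrt 2 - 1) ->
    0 <= t <= 1 ->
    analytic_on_disk h1 -> analytic_on_disk g1 ->
    analytic_on_disk h2 -> analytic_on_disk g2 ->
    normalized h1 g1 -> normalized h2 g2 ->
    (forall z : C, unit_disk z -> (h1 z + g1 z)%C = F alpha1 n z) ->
    (forall z : C, unit_disk z -> (h2 z + g2 z)%C = F alpha2 m z) ->
    dilatation_lt_1 h1 g1 -> dilatation_lt_1 h2 g2 ->
    let f := fun z : C =>
      (RtoC t * harmonic_of h1 g1 z + RtoC (1 - t) * harmonic_of h2 g2 z)%C in
    locally_univalent f -> sense_preserving f ->
    class_SH f /\ convex_imaginary_direction f.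
Proof.
  intros n m alpha1 alpha2 t h1 g1 h2 g2 Hn Hm Ha1 Ha2 Ht Ah1 Ag1 Ah2 Ag2
    [N1h [N1g N1d]] [N2h [N2g N2d]] HF1 HF2 _ _ f _ Hsp.
  assert (Hs := double_sqrt2_minus_1_le_1).
  assert (Ha1' : Rabs alpha1 <= 1) by (apply Rabs_le; lra).
  assert (Ha2' : Rabs alpha2 <= 1) by (apply Rabs_le; lra).
  set (h := fun z => (t * h1 z + (1 - t)%R * h2 z)%C).
  set (g := fun z => (t * g1 z + (1 - t)%R * g2 z)%C).
  (* The coefficients 1 and - (1) are written out so that [is_Cderive_comb] covers these sums
     too. *)
  set (H := fun z => (1 * h z + 1 * g z)%C).
  set (K := fun z => (1 * h z + - (1) * g z)%C).
  set (h' := fun z => (t * C_derive h1 z + (1 - t)%R * C_derive h2 z)%C).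
  set (g' := fun z => (t * C_derive g1 z + (1 - t)%R * C_derive g2 z)%C).
  set (H' := fun z => (1 * h' z + 1 * g' z)%C).
  set (K' := fun z => (1 * h' z + - (1) * g' z)%C).
  assert (Dh : forall z, unit_disk z -> is_Cderive h z (h' z)).
  { intros z Hz. apply is_Cderive_comb; apply C_derive_correct; auto. }
  assert (Dg : forall z, unit_disk z -> is_Cderive g z (g' z)).
  { intros z Hz. apply is_Cderive_comb; apply C_derive_correct; auto. }
  assert (DH : forall z, unit_disk z -> is_Cderive H z (H' z)).
  { intros z Hz. apply is_Cderive_comb; auto. }
  assert (DK : forall z, unit_disk z -> is_Cderive K z (K' z)).
  { intros z Hz. apply is_Cderive_comb; auto. }
  (* [H] agrees on the disk with the same combination of the functions [F], so uniqueness of the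
     derivative applies. *)
  assert (EH : forall z, unit_disk z ->
    H' z = (t * F_deriv alpha1 n z + (1 - t)%R * F_deriv alpha2 m z)%C).
  { intros z Hz. rewrite <- (is_C_derive_unique _ _ _ (DH z Hz)).
    apply is_C_derive_unique.
    apply is_Cderive_ext_disk with (fun z => t * F alpha1 n z + (1 - t)%R * F alpha2 m z)%C.
    - exact Hz.
    - intros w Hw. rewrite <- HF1, <- HF2 by exact Hw. unfold H, h, g. ring.
    - apply is_Cderive_comb; now apply is_Cderive_F. }
  assert (Hf : forall w, f w = (Re (H w), Im (K w))).
  { intros w. unfold f, H, K, h, g, harmonic_of.
    destruct (h1 w), (h2 w), (g1 w), (g2 w).
    apply injective_projections; simpl; ring. }
  assert (Hpos : forall z, unit_disk z -> 0 < Re ((1 - z * z) * H' z)%C).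
  { intros z Hz. rewrite (EH z Hz).
    assert (P1 := Re_F_deriv_pos alpha1 n z Ha1' Hn Hz).
    assert (P2 := Re_F_deriv_pos alpha2 m z Ha2' Hm Hz).
    replace ((1 - z * z) * (t * F_deriv alpha1 n z + (1 - t)%R * F_deriv alpha2 m z))%C
      with (t * ((1 - z * z) * F_deriv alpha1 n z) + (1 - t)%R * ((1 - z * z) * F_deriv alpha2 m z))%C by ring.
    rewrite re_plus, !re_scal_l.
    (* One of t and 1 - t is at least 1 / 2, so the combination of two positive numbers stays
       strictly positive. *)
    destruct (Rle_lt_dec t (1 / 2)); nra. }
  assert (Hjac : forall z, unit_disk z -> 0 < Re (K' z * Cconj (H' z))%C).
  { intros z Hz. assert (J := Hsp z Hz). unfold jacobian in J.
    destruct (wirtinger_of_shear f H K z _ _ Hf (DH z Hz) (DK z Hz)) as [E1 E2].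
    rewrite E1, E2, Re_mult_conj_half_sum in J. exact J. }
  destruct (F_deriv_bounded_near_pm1 alpha1 n) as [d1 [B1 [Hd1 HB1]]].
  destruct (F_deriv_bounded_near_pm1 alpha2 m) as [d2 [B2 [Hd2 HB2]]].
  assert (Hbound : forall z, unit_disk z ->
    Cmod (z - 1)%C < Rmin d1 d2 \/ Cmod (z + 1)%C < Rmin d1 d2 ->
    Cmod (H' z) <= t * B1 + (1 - t) * B2).
  { intros z Hz Hd. assert (L1 := Rmin_l d1 d2). assert (L2 := Rmin_r d1 d2).
    specialize (HB1 z Hz ltac:(destruct Hd; [left|right]; lra)).
    specialize (HB2 z Hz ltac:(destruct Hd; [left|right]; lra)).
    rewrite (EH z Hz). apply Rle_trans with (1 := Cmod_triangle _ _).
    rewrite !Cmod_mult, !Cmod_R, !Rabs_pos_eq by lra.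
    apply Rplus_le_compat; apply Rmult_le_compat_l; lra. }
  assert (Hdelta := Rmin_glb_lt _ _ _ Hd1 Hd2).
  assert (Huniv := shear_univalent H K H' K' _ _ DH DK Hpos Hjac Hdelta Hbound).
  assert (Hconv := shear_convex_imaginary_direction H K H' K' _ _ DH DK Hpos Hjac Hdelta Hbound).
  split; [split; [|split; [|split; [|split]]]|].
  - exists h, g. split; [|split].
    + intros z Hz. exists (h' z). auto.
    + intros z Hz. exists (g' z). auto.
    + intros z _. rewrite Hf. unfold H, K, harmonic_of.
      destruct (h z), (g z). apply injective_projections; simpl; ring.
  - exact Hsp.
  - intros u v Hu Hv E. apply Huniv; auto. rewrite <- !Hf. exact E.
  - unfold f, harmonic_of. rewrite N1h, N1g, N2h, N2g.
    apply injective_projections; simpl; ring.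
  (* The value is (H'(0) + K'(0)) / 2 = h'(0) = t + (1 - t). *)
  - destruct (wirtinger_of_shear f H K 0 _ _ Hf (DH 0 unit_disk_0) (DK 0 unit_disk_0)) as [E _].
    rewrite E. unfold H', K', h'. rewrite N1d, N2d.
    apply injective_projections; simpl; field.
  (* [f] and the shear agree pointwise; connectedness is transferred through the equivalence of the
     two sets. *)
  - intros c P Q HP HQ Hcov HexP HexQ.
    assert (Heq : forall w, (Re w = c /\ exists z, unit_disk z /\ f z = w) <->
      (Re w = c /\ exists z, unit_disk z /\ (Re (H z), Im (K z)) = w)).
    { intros w. split; intros [Hc [z [Hz E]]]; split; auto; exists z; split; auto.
      - now rewrite <- Hf.
      - now rewrite Hf. }
    destruct (Hconv c P Q HP HQ) as [w [W1 W2]].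
    + intros w Hw. apply Hcov. now apply Heq.
    + destruct HexP as [w [W1 W2]]. exists w. split; [now apply Heq|exact W2].
    + destruct HexQ as [w [W1 W2]]. exists w. split; [now apply Heq|exact W2].
    + exists w. split; [now apply Heq|exact W2].
Qed.
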